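(* For each $t\in\{3,5,6,7,8,9\}$, the problem List $3$-Colouring is solvable in polynomial time when the input graphs are restricted to $(C_4,C_t)$-free graphs of diameter $2$.
   Context: Graphs are finite, simple and undirected. $C_s$ denotes the cycle on $s$ vertices. A graph $G$ is $(H_1,H_2)$-free if $G$ contains neither $H_1$ nor $H_2$ as an induced subgraph. The distance between two vertices is the number of edges of a shortest path between them, and the diameter of $G$ is the maximum distance over all pairs of vertices of $G$. A colouring of $G=(V,E)$ is a map $c$ from $V$ to the positive integers with $c(u)\neq c(v)$ for every two adjacent vertices $u,v$. A list $3$-assignment of $G$ is a function $L$ assigning to each $u\in V$ a list $L(u)\subseteq\{1,2,3\}$. A colouring $c$ respects $L$ if $c(u)\in L(u)$ for every $u\in V$. The problem List $3$-Colouring takes as input a graph $G$ with a list $3$-assignment $L$ and asks whether $G$ has a colouring that respects $L$. *)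

(* Defs.v *)
From mathcomp Require Import all_boot.

Set Implicit Arguments.
Unset Strict Implicit.
Unset Printing Implicit Defensive.

(** * Graphs *)

(* The vertices are numbered so that a graph can be written on an input tape;
   the numbering carries no other information. *)
Record sgraph := SGraph {
  order : nat;
  adj : rel 'I_order;
  adj_sym : symmetric adj;
  adj_irr : irreflexive adj
}.

Notation vertex G := 'I_(order G).

Definition induced_in (H G : sgraph) : Prop :=
  exists f : vertex H -> vertex G,
    injective f /\ forall x y, adj (f x) (f y) = adj x y.

Definition free2 (H1 H2 G : sgraph) : Prop :=
  ~ induced_in H1 G /\ ~ induced_in H2 G.

(* The conjunct [i != j] only matters for [s = 1]; this is the cycle on [s]
   vertices when [3 <= s]. *)
Definition cycle_adj (s : nat) : rel 'I_s :=
  fun i j => (i != j) && ((j == i.+1 %% s :> nat) || (i == j.+1 %% s :> nat)).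

Lemma cycle_adj_sym s : symmetric (@cycle_adj s).
Proof. by move=> i j; rewrite /cycle_adj eq_sym orbC. Qed.

Lemma cycle_adj_irr s : irreflexive (@cycle_adj s).
Proof. by move=> i; rewrite /cycle_adj eqxx. Qed.

Definition Cycle (s : nat) : sgraph :=
  SGraph (@cycle_adj_sym s) (@cycle_adj_irr s).

Definition joined_by (G : sgraph) (u v : vertex G) (d : nat) : Prop :=
  exists p : seq (vertex G),
    [/\ path (@adj G) u p, uniq (u :: p), last u p = v & size p = d].

Definition distance (G : sgraph) (u v : vertex G) (d : nat) : Prop :=
  joined_by u v d /\ forall d', joined_by u v d' -> d <= d'.

(* A disconnected graph, and the graph without vertices, have no diameter. *)
Definition diameter (G : sgraph) (d : nat) : Prop :=
  (forall u v : vertex G, exists2 d', distance u v d' & d' <= d)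
  /\ exists u v : vertex G, distance u v d.

(** * List 3-Colouring *)

Definition colouring (G : sgraph) (c : vertex G -> nat) : Prop :=
  (forall u, 0 < c u) /\ (forall u v, adj u v -> c u <> c v).

Record l3c_instance := L3CInstance {
  l3c_graph : sgraph;
  l3c_list : vertex l3c_graph -> pred nat;
  l3c_list_sub : forall u c, l3c_list u c -> c \in [:: 1; 2; 3]
}.

Definition respects (x : l3c_instance) (c : vertex (l3c_graph x) -> nat) : Prop :=
  forall u, l3c_list u (c u).

Definition l3c_yes (x : l3c_instance) : Prop :=
  exists c : vertex (l3c_graph x) -> nat, colouring c /\ respects c.

(* The number of vertices in unary (ended by a 0), then the adjacency matrix
   row by row, then three bits per vertex for its list. *)
Definition l3c_encode (x : l3c_instance) : seq bool :=
  let G := l3c_graph x in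
  nseq (order G) true ++ [:: false]
  ++ [seq adj u v | u <- enum (vertex G), v <- enum (vertex G)]
  ++ [seq l3c_list u c | u <- enum (vertex G), c <- [:: 1; 2; 3]].

(** * Polynomial time *)

(* Random access machines with natural-number registers and memory cells, in
   the style of Cook and Reckhow.  There is no multiplication, so the largest
   number in a run at most doubles with each step (up to the constants of the
   program): unit cost is polynomially equivalent to time on a Turing
   machine. *)
Inductive instr : Type :=
  | Const of nat & nat          (* r_i := c *)
  | Add of nat & nat & nat      (* r_i := r_j + r_k *)
  | Sub of nat & nat & nat      (* r_i := r_j - r_k, truncated at 0 *)
  | Fetch of nat & nat          (* r_i := mem[r_j] *)
  | Put of nat & nat            (* mem[r_i] := r_j *)
  | Jpos of nat & nat.          (* if r_i > 0, go to instruction l *)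

Definition program := seq instr.

Record state := State { pc : nat; reg : nat -> nat; mem : nat -> nat }.

Definition upd (f : nat -> nat) (i v : nat) : nat -> nat :=
  fun j => if j == i then v else f j.

Definition exec (a : instr) (s : state) : state :=
  let: State p r m := s in
  match a with
  | Const i c => State p.+1 (upd r i c) m
  | Add i j k => State p.+1 (upd r i (r j + r k)) m
  | Sub i j k => State p.+1 (upd r i (r j - r k)) m
  | Fetch i j => State p.+1 (upd r i (m (r j))) m
  | Put i j => State p.+1 r (upd m (r i) (r j))
  | Jpos i l => State (if 0 < r i then l else p.+1) r m
  end.

(* The machine halts when the program counter leaves the program. *)
Definition halted (P : program) (s : state) : bool := size P <= pc s.

Definition step (P : program) (s : state) : state :=
  if onth P (pc s) is Some a then exec a s else s.

(* The input is followed by zeros, so encodings should be self-delimiting. *)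
Definition init (w : seq bool) : state :=
  State 0 (fun=> 0) (fun i => nat_of_bool (nth false w i)).

Definition accepting (s : state) : bool := 0 < reg s 0.

(* [P] need only behave correctly on the instances in the class [A]. *)
Definition poly_time_solvable (I : Type) (encode : I -> seq bool)
    (A yes : I -> Prop) : Prop :=
  exists (P : program) (c k : nat), forall x : I, A x ->
    exists T : nat,
      [/\ T <= c * size (encode x) ^ k + c,
          halted P (iter T (step P) (init (encode x)))
        & accepting (iter T (step P) (init (encode x))) <-> yes x].

Definition list_3_colouring_poly_time_on (C : sgraph -> Prop) : Prop :=
  poly_time_solvable l3c_encode (fun x => C (l3c_graph x)) l3c_yes.

(* Main.v *)
Require Import Defs.
From mathcomp Require Import all_boot.
From mathcomp Require Import zify.

(* There is a constant M such that every graph of the class that has a proper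
   3-colouring also has a dominating set of at most M vertices.

   For t >= 5, choose vertices z_0, z_1, ... so that each z_k is neither in nor
   adjacent to the set obtained from z_0, ..., z_{k-1} by adding three times
   all common neighbours of non-adjacent pairs.  A non-adjacent pair has at
   most two common neighbours, so if this process stops early it has found a
   small dominating set.  Otherwise Ramsey's theorem gives nine of the z's
   whose pairwise common neighbours y_ab all have the same colour, hence are
   pairwise non-adjacent.  Alternating z's and y's gives induced C_6 and C_8;
   joining w = y_01 to a third z_j through a common neighbour changes the
   parity and gives induced C_5, C_7 and C_9.

   For t = 3, unless one or two vertices and their neighbours exhaust the
   graph, it is d-regular with d^2 + 1 vertices; counting the edges and the
   pairs of vertices in a colour class of at least a third of the vertices
   then forces d < 6.

   The algorithm guesses the vertices of a total dominating set together with
   their colours.  Every vertex is left with at most two colours, and such an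
   instance is solved by eliminating the vertices one by one.  It is written
   in a small language of bounded loops that is compiled to the machine. *)

Set Implicit Arguments.
Unset Strict Implicit.
Unset Printing Implicit Defensive.

(** * Bounded-loop programs and their compilation *)

(* Variables are de Bruijn levels.  Variable 0 holds the number n of vertices
   and is the bound of every sum and of every loop. *)
Inductive expr : Type :=
  | Cst of nat
  | Var of nat
  | Plus of expr & expr
  | Minus of expr & expr
  | Read of expr
  | Sum of expr.

Inductive stmt : Type :=
  | Store of expr & expr
  | Seq of stmt & stmt
  | For of stmt.

(** The environment grows at its end, so a level keeps its meaning under further binders. [Sum] also
    replaces multiplication: over a body that ignores the new variable it multiplies by n. *)
Fixpoint eval (m : nat -> nat) (rho : seq nat) (e : expr) : nat :=
  match e with
  | Cst c => c
  | Var i => nth 0 rho i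
  | Plus a b => eval m rho a + eval m rho b
  | Minus a b => eval m rho a - eval m rho b
  | Read a => m (eval m rho a)
  | Sum a => \sum_(0 <= k < nth 0 rho 0) eval m (rcons rho k) a
  end.

Fixpoint den (rho : seq nat) (s : stmt) (m : nat -> nat) : nat -> nat :=
  match s with
  | Store a b => upd m (eval m rho a) (eval m rho b)
  | Seq s1 s2 => den rho s2 (den rho s1 m)
  | For s => foldl (fun m k => den (rcons rho k) s m) m (iota 0 (nth 0 rho 0))
  end.

(** Exact step counts rather than upper bounds, so that runs of compiled pieces can be chained by
    adding their lengths. *)
Fixpoint ecost (N : nat) (e : expr) : nat :=
  match e with
  | Cst _ => 1
  | Var _ => 2
  | Plus a b | Minus a b => ecost N a + ecost N b + 1
  | Read a => ecost N a + 1
  | Sum a => 6 + N * (ecost N a + 5)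
  end.

Fixpoint scost (N : nat) (s : stmt) : nat :=
  match s with
  | Store a b => ecost N a + ecost N b + 1
  | Seq s1 s2 => scost N s1 + scost N s2
  | For s => 5 + N * (scost N s + 4)
  end.

(* Variables live in even registers and temporaries in odd ones. *)
Definition vreg (i : nat) := i.*2.
Definition treg (j : nat) := j.*2.+1.

(** The loop is entered at the test, which is at offset [size body + 5], so a bound of 0 skips the
    body; the constant 1 makes the entry jump unconditional. *)
Definition loop (l d t : nat) (body : seq instr) : seq instr :=
  [:: Const (vreg d) 0; Const (treg t) 1; Jpos (treg t) (l + size body + 5)]
  ++ body
  ++ [:: Const (treg t) 1; Add (vreg d) (vreg d) (treg t);
         Defs.Sub (treg t) (vreg 0) (vreg d); Jpos (treg t) (l + 3)].

(** Here l is the address of the code and d the number of variables in scope; temporaries below t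
    are live, and the result goes to [treg t]. A variable out of scope yields 0, like the default of
    [nth] in [eval]. *)
Fixpoint ecomp (l d t : nat) (e : expr) : seq instr :=
  match e with
  | Cst c => [:: Const (treg t) c]
  | Var i => [:: Const (treg t) 0;
                 if i < d then Add (treg t) (treg t) (vreg i)
                 else Const (treg t) 0]
  | Plus a b =>
      let ca := ecomp l d t a in
      ca ++ ecomp (l + size ca) d t.+1 b ++ [:: Add (treg t) (treg t) (treg t.+1)]
  | Minus a b =>
      let ca := ecomp l d t a in
      ca ++ ecomp (l + size ca) d t.+1 b ++ [:: Defs.Sub (treg t) (treg t) (treg t.+1)]
  | Read a => ecomp l d t a ++ [:: Fetch (treg t) (treg t)]
  | Sum a =>
      Const (treg t) 0 ::
      loop l.+1 d t.+1
        (ecomp (l + 4) d.+1 t.+1 a ++ [:: Add (treg t) (treg t) (treg t.+1)])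
  end.

Fixpoint scomp (l d : nat) (s : stmt) : seq instr :=
  match s with
  | Store a b =>
      let ca := ecomp l d 0 a in
      ca ++ ecomp (l + size ca) d 1 b ++ [:: Put (treg 0) (treg 1)]
  | Seq s1 s2 =>
      let c1 := scomp l d s1 in c1 ++ scomp (l + size c1) d s2
  | For s => loop l d 0 (scomp (l + 3) d.+1 s)
  end.

(** * Correctness of the compiler *)

Definition placed (P : program) (l : nat) (c : seq instr) : Prop :=
  exists p q, P = p ++ c ++ q /\ size p = l.

Lemma placed_cat P l c1 c2 :
  placed P l (c1 ++ c2) -> placed P l c1 /\ placed P (l + size c1) c2.
Proof.
case=> p [q [-> <-]]; split; first by exists p, (c2 ++ q); rewrite -!catA.
by exists (p ++ c1), q; rewrite size_cat -!catA.
Qed.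

Lemma step_placed P l a c r m :
  placed P l (a :: c) -> step P (State l r m) = exec a (State l r m).
Proof.
case=> p [q [-> <-]].
by rewrite /step /= onthE map_cat nth_cat size_map ltnn subnn /=.
Qed.

Lemma placed_tl P l a c : placed P l (a :: c) -> placed P l.+1 c.
Proof. by rewrite -cat1s => /placed_cat[_]; rewrite addn1. Qed.

Lemma iter_add T1 T2 P s :
  iter (T1 + T2) (step P) s = iter T2 (step P) (iter T1 (step P) s).
Proof. by rewrite addnC iterD. Qed.

Lemma updE (f : nat -> nat) i v j : upd f i v j = if j == i then v else f j.
Proof. by []. Qed.

Lemma vreg_eq i j : (vreg i == vreg j) = (i == j).
Proof. by rewrite /vreg; lia. Qed.
Lemma treg_eq i j : (treg i == treg j) = (i == j).
Proof. by rewrite /treg; lia. Qed.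
Lemma vtreg_eq i j : (vreg i == treg j) = false.
Proof. by rewrite /vreg /treg; lia. Qed.
Lemma tvreg_eq i j : (treg i == vreg j) = false.
Proof. by rewrite /vreg /treg; lia. Qed.
Definition reg_eqE := (updE, vreg_eq, treg_eq, vtreg_eq, tvreg_eq).

Section Loop.
Variables (P : program) (l d t N c : nat) (body : seq instr).
Variable Inv : nat -> (nat -> nat) -> (nat -> nat) -> Prop.
Hypotheses (HP : placed P l (loop l d t body)) (d_gt0 : 0 < d).
Hypothesis Inv_ext : forall k r1 r2 m,
  (forall x, x != vreg d -> x != treg t -> r1 x = r2 x) ->
  Inv k r1 m -> Inv k r2 m.
Hypothesis Inv_N : forall k r m, Inv k r m -> r (vreg 0) = N.
Hypothesis Hbody : forall k r m, k < N -> r (vreg d) = k -> Inv k r m ->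
  exists r' m', [/\ iter c (step P) (State (l + 3) r m)
                      = State (l + 3 + size body) r' m',
                    r' (vreg d) = k & Inv k.+1 r' m'].

(** The run starts at the test with j rounds left. A round takes 2 steps for the test, c for the
    body and 2 for the increment; the failing last test adds 2. *)
Lemma loop_from j k r m : j + k = N -> r (vreg d) = k -> Inv k r m ->
  exists r' m', iter (j * (c + 4) + 2) (step P) (State (l + size body + 5) r m)
    = State (l + size body + 7) r' m' /\ Inv N r' m'.
Proof.
have [_ /placed_cat[Hb He]] := placed_cat HP.
have He2 := placed_tl (placed_tl He); rewrite /= -!addnS in He2.
have eqA : l + 3 + (size body).+2 = l + size body + 5 by lia.
have eqB : l + 3 + size body = l + size body + 3 by lia.
rewrite eqA in He2; rewrite eqB in He.
have test r0 m0 k0 : r0 (vreg d) = k0 -> Inv k0 r0 m0 ->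
    exists2 r1, iter 2 (step P) (State (l + size body + 5) r0 m0)
      = State (if k0 < N then l + 3 else l + size body + 7) r1 m0 &
      r1 (vreg d) = k0 /\ Inv k0 r1 m0.
  move=> rk I0; have rN := Inv_N I0.
  have He3 := placed_tl He2.
  rewrite /= (step_placed _ _ He2) /= (step_placed _ _ He3) /= !reg_eqE eqxx rk rN subn_gt0.
  exists (upd r0 (treg t) (N - k0)).
    by congr State; case: ifP => // _; lia.
  rewrite !reg_eqE rk; split=> //.
  by apply: Inv_ext I0 => x _ xt; rewrite updE (negbTE xt).
elim: j k r m => [|j IHj] k r m jk rk Ik.
  have [r1 E [_ I1]] := test r m k rk Ik.
  exists r1, m; rewrite add0n in jk; rewrite mul0n add0n E jk ltnn.
  by split=> //; rewrite -jk.
have [r1 E [rk1 I1]] := test r m k rk Ik.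
have kN : k < N by lia.
have [r2 [m2 [E2 rk2 I2]]] := Hbody kN rk1 I1.
have -> : j.+1 * (c + 4) + 2 = 2 + (c + (2 + (j * (c + 4) + 2))) by lia.
rewrite iter_add E kN iter_add E2 iter_add eqB /= (step_placed _ _ He) /=.
rewrite (step_placed _ _ (placed_tl He)) /= !reg_eqE !eqxx rk2.
have -> : (l + size body + 3).+2 = l + size body + 5 by lia.
apply: (IHj k.+1); first by lia.
  by rewrite updE eqxx addn1.
by apply: Inv_ext I2 => x xd xt; rewrite !updE (negbTE xd) (negbTE xt).
Qed.

Lemma loop_ok r m : Inv 0 r m ->
  exists r' m', iter (5 + N * (c + 4)) (step P) (State l r m)
    = State (l + size (loop l d t body)) r' m' /\ Inv N r' m'.
Proof.
move=> I0; have [HA _] := placed_cat HP.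
have -> : 5 + N * (c + 4) = 3 + (N * (c + 4) + 2) by lia.
have -> : l + size (loop l d t body) = l + size body + 7.
  by rewrite /loop !size_cat /=; lia.
rewrite iter_add /= (step_placed _ _ HA) /= (step_placed _ _ (placed_tl HA)) /=.
rewrite (step_placed _ _ (placed_tl (placed_tl HA))) /= !reg_eqE eqxx /=.
apply: (@loop_from N 0); rewrite ?addn0 ?reg_eqE ?eqxx //.
by apply: Inv_ext I0 => x xd xt; rewrite !updE (negbTE xd) (negbTE xt).
Qed.
End Loop.

Definition vars (d : nat) (r : nat -> nat) : seq nat := mkseq (fun i => r (vreg i)) d.

Definition preserved (d t : nat) (r r' : nat -> nat) : Prop :=
  (forall i, i < d -> r' (vreg i) = r (vreg i)) /\
  (forall j, j < t -> r' (treg j) = r (treg j)).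

Lemma vars_preserved d t r r' : preserved d t r r' -> vars d r' = vars d r.
Proof.
case=> H _; apply: (@eq_from_nth _ 0); rewrite !size_mkseq // => i lt_id.
by rewrite !nth_mkseq ?H.
Qed.

Lemma preserved_trans d t d' t' r1 r2 r3 : d <= d' -> t <= t' ->
  preserved d t r1 r2 -> preserved d' t' r2 r3 -> preserved d t r1 r3.
Proof.
move=> dd tt [A1 B1] [A2 B2]; split=> i lt_i.
  by rewrite A2 ?A1 // (leq_trans lt_i).
by rewrite B2 ?B1 // (leq_trans lt_i).
Qed.

Lemma preserved_upd d t r v : preserved d t r (upd r (treg t) v).
Proof. by split=> i lt_i; rewrite !reg_eqE // ltn_eqF. Qed.

Lemma vars_rcons d r : vars d.+1 r = rcons (vars d r) (r (vreg d)).
Proof. by rewrite /vars /mkseq -addn1 iotaD map_cat cats1. Qed.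

Lemma nth_vars d r i : nth 0 (vars d r) i = if i < d then r (vreg i) else 0.
Proof.
by case: ltnP => H; [rewrite nth_mkseq | rewrite nth_default ?size_mkseq].
Qed.

Definition ecomp_spec (P : program) (e : expr) := forall l d t r m,
  placed P l (ecomp l d t e) -> 0 < d ->
  exists r', [/\ iter (ecost (r (vreg 0)) e) (step P) (State l r m)
                   = State (l + size (ecomp l d t e)) r' m,
                 r' (treg t) = eval m (vars d r) e & preserved d t r r'].

Lemma ecomp_bin P a b (f : nat -> nat -> nat) (i : nat -> nat -> nat -> instr) :
  (forall x y z p r m, exec (i x y z) (State p r m) = State p.+1 (upd r x (f (r y) (r z))) m) ->
  ecomp_spec P a -> ecomp_spec P b -> forall l d t r m,
  let c := ecomp l d t a ++ ecomp (l + size (ecomp l d t a)) d t.+1 b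
             ++ [:: i (treg t) (treg t) (treg t.+1)] in
  placed P l c -> 0 < d ->
  exists r', [/\ iter (ecost (r (vreg 0)) a + ecost (r (vreg 0)) b + 1) (step P)
                   (State l r m) = State (l + size c) r' m,
                 r' (treg t) = f (eval m (vars d r) a) (eval m (vars d r) b)
               & preserved d t r r'].
Proof.
move=> Hi IHa IHb l d t r m /= /placed_cat[Pa /placed_cat[Pb Pi]] d0.
have [r1 [E1 V1 K1]] := IHa _ _ _ r m Pa d0.
have [r2 [E2 V2 K2]] := IHb _ _ _ r1 m Pb d0.
exists (upd r2 (treg t) (f (r2 (treg t)) (r2 (treg t.+1)))); split.
- rewrite -addnA iter_add E1 iter_add; move: E2; rewrite (proj1 K1 _ d0) => ->.
  by rewrite /= (step_placed _ _ Pi) Hi !size_cat; congr State => /=; lia.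
- by rewrite updE eqxx V2 (vars_preserved K1) (proj2 K2) // V1.
- apply: (preserved_trans (leqnn d) (leqnn t)) (preserved_upd _ _ _ _).
  exact: (preserved_trans (leqnn d) (leqnSn t)) K1 K2.
Qed.

Lemma ecomp_ok P e : ecomp_spec P e.
Proof.
elim: e => [c|i|a IHa b IHb|a IHa b IHb|a IHa|a IHa] l d t r m.
- move=> H d0; exists (upd r (treg t) c); rewrite /= (step_placed _ _ H) addn1 updE eqxx.
  by split=> //; apply: preserved_upd.
- move=> H d0.
  exists (upd (upd r (treg t) 0) (treg t) (nth 0 (vars d r) i)).
  rewrite updE eqxx; split=> //; last first.
    by apply: (preserved_trans (leqnn d) (leqnn t)); apply: preserved_upd.
  rewrite [LHS]/= (step_placed _ _ H) /= (step_placed _ _ (placed_tl H)) nth_vars addn2.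
  by case: ifP => _ /=; rewrite ?reg_eqE ?eqxx.
- exact: (ecomp_bin (f := addn) (i := Add)).
- exact: (ecomp_bin (f := subn) (i := Defs.Sub)).
- move=> /= /placed_cat[Pa Pi] d0.
  have [r1 [E1 V1 K1]] := IHa _ _ _ r m Pa d0.
  exists (upd r1 (treg t) (m (r1 (treg t)))); split.
  + by rewrite iter_add E1 /= (step_placed _ _ Pi) /= size_cat /=; congr State; lia.
  + by rewrite updE eqxx V1.
  + exact: (preserved_trans (leqnn d) (leqnn t)) K1 (preserved_upd _ _ _ _).
- move=> H d0; set N := r (vreg 0).
  have -> : ecost N (Sum a) = 1 + (5 + N * (ecost N a + 1 + 4)) by rewrite /=; lia.
  move: H; rewrite [ecomp _ _ _ _]/=; set body := _ ++ _ => H.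
  have Pl := placed_tl H.
  have Pb : placed P (l + 4) body.
    by have [_ /placed_cat[]] := placed_cat Pl; rewrite /= addSn -addnS.
  have [Pa Pi] := placed_cat Pb.
  (* After k rounds [treg t] holds the sum of the first k values; the body works from [treg t.+1]
     upwards. *)
  pose S k := \sum_(0 <= i < k) eval m (rcons (vars d r) i) a.
  pose Inv k r' (m' : nat -> nat) :=
    [/\ m' = m, preserved d t r r' & r' (treg t) = S k].
  have [] := @loop_ok P l.+1 d t.+1 N (ecost N a + 1) body Inv Pl d0 _ _ _
    (upd r (treg t) 0) m.
  + move=> k r1 r2 _ E [-> [K1 K2] V]; split=> //.
      split=> j lt_j; rewrite -E ?reg_eqE ?K1 ?K2 //; lia.
    by rewrite -E // reg_eqE; lia.
  + by move=> k r1 _ [_ [K1 _] _]; apply: K1.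
  + move=> k r1 _ kN r1d [-> K V].
    have d0' : 0 < d.+1 by [].
    have [r2 [E2 V2 K2]] := IHa _ _ _ r1 m Pa d0'.
    exists (upd r2 (treg t) (r2 (treg t) + r2 (treg t.+1))), m; split.
    * have -> : l.+1 + 3 = l + 4 by lia.
      rewrite iter_add -[N](proj1 K _ d0) E2 /= (step_placed _ _ Pi) /= size_cat /=.
      by congr State; lia.
    * by rewrite !reg_eqE (proj1 K2).
    * split=> //.
        apply: (preserved_trans (leqnn d) (leqnn t)) (preserved_upd _ _ _ _).
        exact: (preserved_trans (leqnSn d) (leqnSn t)) K K2.
      rewrite updE eqxx V2 (proj2 K2) // V /S big_nat_recr //=.
      by rewrite vars_rcons r1d (vars_preserved K).
  + split=> //; first exact: preserved_upd.
    by rewrite updE eqxx /S big_geq.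
  + move=> r1 [m1 []] /[swap] -[-> K V] E1; exists r1; split=> //.
      rewrite iter_add [iter 1 _ _]/= (step_placed _ _ H) [exec _ _]/= E1.
      by congr State; rewrite addSnnS.
    by rewrite V /= nth_vars d0.
Qed.

Lemma scomp_ok P s l d r m : placed P l (scomp l d s) -> 0 < d ->
  exists r', [/\ iter (scost (r (vreg 0)) s) (step P) (State l r m)
                   = State (l + size (scomp l d s)) r' (den (vars d r) s m)
               & preserved d 0 r r'].
Proof.
elim: s l d r m => [a b|s1 IH1 s2 IH2|s IHs] l d r m.
- move=> /= /placed_cat[Pa /placed_cat[Pb Pi]] d0.
  have [r1 [E1 V1 K1]] := ecomp_ok r m Pa d0.
  have [r2 [E2 V2 K2]] := ecomp_ok r1 m Pb d0.
  exists r2; split; last exact: preserved_trans K1 K2.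
  rewrite -addnA iter_add E1 iter_add -[r (vreg 0)](proj1 K1 _ d0) E2.
  rewrite /= (step_placed _ _ Pi) /= V2 (vars_preserved K1) (proj2 K2) // V1.
  by congr State; rewrite !size_cat /=; lia.
- move=> /= /placed_cat[P1 P2] d0.
  have [r1 [E1 K1]] := IH1 _ _ r m P1 d0.
  have [r2 [E2 K2]] := IH2 _ _ r1 (den (vars d r) s1 m) P2 d0.
  exists r2; split; last exact: preserved_trans K1 K2.
  rewrite iter_add E1 -[r (vreg 0)](proj1 K1 _ d0) E2 size_cat addnA.
  by rewrite (vars_preserved K1).
- move=> H d0; rewrite [scost _ _]/=; set N := r (vreg 0).
  have [_ /placed_cat[Pb _]] := placed_cat H.
  pose M k := foldl (fun m k => den (rcons (vars d r) k) s m) m (iota 0 k).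
  pose Inv k r' m' := m' = M k /\ preserved d 0 r r'.
  have [] := @loop_ok P l d 0 N (scost N s) _ Inv H d0 _ _ _ r m.
  + move=> k r1 r2 _ E [-> [K1 K2]]; split=> //.
    by split=> // j lt_j; rewrite -E ?reg_eqE ?K1 //; lia.
  + by move=> k r1 _ [_ [K1 _]]; apply: K1.
  + move=> k r1 _ kN r1d [-> K].
    have d0' : 0 < d.+1 by [].
    have [r2 [E2 K2]] := IHs _ _ r1 (M k) Pb d0'.
    exists r2, (M k.+1); split; last 1 first.
    * by split=> //; apply: preserved_trans K K2.
    * move: E2; rewrite (proj1 K _ d0) => ->; congr State.
      rewrite vars_rcons r1d (vars_preserved K).
      by rewrite /M -[k.+1]addn1 iotaD foldl_cat.
    * by rewrite (proj1 K2).
  + by [].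
  + move=> r1 [m1 []] /[swap] -[-> K] E1; exists r1; split=> //.
    by rewrite E1 /= nth_vars d0.
Qed.

(** * Polynomial running time *)

Definition poly_bounded (f : nat -> nat) : Prop :=
  exists C k, forall N, f N <= C * N.+1 ^ k.

Lemma poly_bounded_const c : poly_bounded (fun=> c).
Proof. by exists c, 0 => N; rewrite expn0 muln1. Qed.

Lemma poly_bounded_id : poly_bounded id.
Proof. by exists 1, 1 => N; rewrite expn1 mul1n. Qed.

Lemma poly_boundedD f g : poly_bounded f -> poly_bounded g ->
  poly_bounded (fun N => f N + g N).
Proof.
case=> C [k Hf] [D [j Hg]]; exists (C + D), (k + j) => N.
rewrite mulnDl leq_add //.
  (* The base [N.+1] is positive even for N = 0, so a larger exponent can only help. *)
  by apply: leq_trans (Hf N) _; rewrite leq_mul2l leq_pexp2l ?leq_addr ?orbT.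
by apply: leq_trans (Hg N) _; rewrite leq_mul2l leq_pexp2l ?leq_addl ?orbT.
Qed.

Lemma poly_boundedM f g : poly_bounded f -> poly_bounded g ->
  poly_bounded (fun N => f N * g N).
Proof.
case=> C [k Hf] [D [j Hg]]; exists (C * D), (k + j) => N.
by rewrite expnD mulnACA leq_mul.
Qed.

Lemma ecost_poly e : poly_bounded (fun N => ecost N e).
Proof.
elim: e => [c|i|a IHa b IHb|a IHa b IHb|a IHa|a IHa] /=;
  repeat first [ assumption | exact: poly_bounded_const | exact: poly_bounded_id
               | apply: poly_boundedD | apply: poly_boundedM ].
Qed.

Lemma scost_poly s : poly_bounded (fun N => scost N s).
Proof.
elim: s => [a b|s1 IH1 s2 IH2|s IHs] /=;
  repeat first [ assumption | exact: ecost_poly | exact: poly_bounded_const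
               | exact: poly_bounded_id | apply: poly_boundedD | apply: poly_boundedM ].
Qed.

(* The input starts with n ones followed by a zero; n is left in register 0,
   the register of variable 0. *)
Definition read_size : seq instr :=
  [:: Const 3 1; Fetch 1 0; Defs.Sub 1 3 1; Jpos 1 6; Add 0 0 3; Jpos 3 1].

(** The statement starts at address 6, the length of [read_size], with variable 0 alone in scope.
    The result arrives in register 1, which is [treg 0], and is copied to the register tested by
    [accepting]. *)
Definition ram (s : stmt) (out : expr) : program :=
  let cs := scomp 6 1 s in
  read_size ++ cs ++ ecomp (6 + size cs) 1 0 out ++ [:: Const 0 0; Add 0 0 1].

(** Register 0 is both the address read and the count of ones; register 1 receives the negated bit,
    so the first zero triggers the exit. Each one costs 5 steps, the set-up 1 and the final zero
    3. *)
Lemma read_size_ok P n m : placed P 0 read_size ->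
  (forall i, i < n -> m i = 1) -> m n = 0 ->
  exists2 r, iter (4 + 5 * n) (step P) (State 0 (fun=> 0) m) = State 6 r m & r 0 = n.
Proof.
move=> H m1 m0.
have [H1 H2] := (placed_tl H, placed_tl (placed_tl H)).
have [H3 H4] := (placed_tl H2, placed_tl (placed_tl H2)).
have H5 := placed_tl H4.
have loop j k r : j + k = n -> r 0 = k -> r 3 = 1 ->
    exists2 r', iter (3 + 5 * j) (step P) (State 1 r m) = State 6 r' m & r' 0 = n.
  elim: j k r => [|j IHj] k r jk r0 r3.
    rewrite add0n in jk; rewrite /= (step_placed _ _ H1) /= (step_placed _ _ H2) /=.
    rewrite (step_placed _ _ H3) /= !updE /= r0 r3 jk m0.
    by eexists; first by []; rewrite /= !updE /= r0.
  have -> : 3 + 5 * j.+1 = 5 + (3 + 5 * j) by lia.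
  rewrite iter_add /= (step_placed _ _ H1) /= (step_placed _ _ H2) /=.
  rewrite (step_placed _ _ H3) /= !updE /= r0 r3 m1; last by lia.
  rewrite (step_placed _ _ H4) /= (step_placed _ _ H5) /= !updE /= r3 /=.
  by apply: (IHj k.+1); rewrite ?updE /= ?r0 ?r3 ?addn1 //; lia.
have -> : 4 + 5 * n = 1 + (3 + 5 * n) by lia.
rewrite iter_add /= (step_placed _ _ H) /=.
by apply: (loop n 0); rewrite ?addn0.
Qed.

Lemma ram_ok s out n m : (forall i, i < n -> m i = 1) -> m n = 0 ->
  let f := iter (6 + 5 * n + scost n s + ecost n out) (step (ram s out))
             (State 0 (fun=> 0) m) in
  halted (ram s out) f /\ reg f 0 = eval (den [:: n] s m) [:: n] out.
Proof.
move=> m1 m0.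
have H : placed (ram s out) 0 (ram s out) by exists [::], [::]; rewrite cats0.
have [/read_size_ok/(_ m1 m0)[r1 E1 r1n] /placed_cat[Hs /placed_cat[He Hf]]] := placed_cat H.
have [r2 [E2 K2]] := scomp_ok r1 m Hs isT.
have [r3 [E3 V3 K3]] := ecomp_ok r2 (den [:: n] s m) He isT.
have r2n : r2 (vreg 0) = n by rewrite (proj1 K2).
have -> : 6 + 5 * n + scost n s + ecost n out
        = (4 + 5 * n) + (scost n s + (ecost n out + 2)) by lia.
rewrite iter_add E1 iter_add.
move: E2; rewrite [vreg 0]/= r1n => ->.
rewrite iter_add.
have -> : vars 1 r1 = [:: n] by rewrite /vars /mkseq /= r1n.
rewrite r2n in E3; rewrite E3 [iter 2 _ _]/=.
rewrite (step_placed _ _ Hf) [exec _ _]/= (step_placed _ _ (placed_tl Hf)) /=.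
rewrite updE /= !updE /= (V3 : r3 1 = _); split.
  rewrite /halted /= !size_cat /=. lia.
by rewrite /vars /mkseq /= r2n.
Qed.

(** The encoding is longer than n, so a bound polynomial in n + 1 is polynomial in the input
    length. *)
Lemma poly_time_ram (I : Type) (encode : I -> seq bool) (A yes : I -> Prop)
    (s : stmt) (out : expr) :
  (forall x, A x -> exists n w, let m := fun i => nat_of_bool (nth false (encode x) i) in
     encode x = nseq n true ++ false :: w /\
     (0 < eval (den [:: n] s m) [:: n] out <-> yes x)) ->
  poly_time_solvable encode A yes.
Proof.
move=> H.
have [C [k HC]] : poly_bounded (fun n => 6 + 5 * n + scost n s + ecost n out).
  repeat first [ exact: ecost_poly | exact: scost_poly | exact: poly_bounded_const
               | exact: poly_bounded_id | apply: poly_boundedD | apply: poly_boundedM ].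
exists (ram s out), C, k => x /H[n [w [E Hyes]]].
exists (6 + 5 * n + scost n s + ecost n out).
have [] := @ram_ok s out n (fun i => nat_of_bool (nth false (encode x) i)).
- by move=> i lt_in; rewrite E nth_cat size_nseq lt_in nth_nseq lt_in.
- by rewrite E nth_cat size_nseq ltnn subnn.
move=> Hh Ho; split=> //; last by rewrite /accepting Ho.
apply: leq_trans (HC n) (leq_trans _ (leq_addr _ _)).
rewrite leq_mul2l; case: k {HC} => [|k]; first by rewrite orbT.
by rewrite leq_exp2r // E size_cat size_nseq /= addnS ltnS leq_addr orbT.
Qed.

(** * Elimination of vertices with two colours *)

Section Elimination.
Variables (n : nat) (U : nat -> nat -> bool) (A : rel nat).

Definition colours3 : seq nat := [:: 0; 1; 2].

(* For v <= u, [compat u i v j] below says that the colours i of u and j of v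
   are compatible once all vertices smaller than v have been eliminated. *)
Fixpoint tab (fuel u i v j : nat) : bool :=
  [&& U u i, if i == j then ~~ A u v else u != v &
      if fuel is f.+1 then
        all (fun w => has (fun k => [&& tab f u i w k, tab f v j w k & tab f w k w k])
                        colours3) (iota 0 v)
      else true].

Definition compat (u i v j : nat) : bool := tab v u i v j.

(** Every recursive call has its second vertex below v, so v units of fuel suffice. *)
Lemma tab_fuel f g u i v j : v <= f -> v <= g -> tab f u i v j = tab g u i v j.
Proof.
elim: f g u i v j => [|f IHf] [|g] u i v j //=.
- by rewrite leqn0 => /eqP->.
- by rewrite leqn0 => _ /eqP->.
move=> vf vg; congr [&& _, _ & _]; apply: eq_in_all => w.
rewrite mem_iota => wv.
have E a b k : tab f a b w k = tab g a b w k by apply: IHf; lia.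
by rewrite !E.
Qed.

Lemma compatE u i v j : compat u i v j =
  [&& U u i, if i == j then ~~ A u v else u != v &
      all (fun w => has (fun k => [&& compat u i w k, compat v j w k & compat w k w k])
                      colours3) (iota 0 v)].
Proof.
rewrite /compat (@tab_fuel v v.+1) //=.
congr [&& _, _ & _]; apply: eq_in_all => w; rewrite mem_iota => wv.
have E a b k : tab v a b w k = tab w a b w k by apply: tab_fuel; lia.
by rewrite !E.
Qed.

(** The second condition leaves at most two colours to each vertex, which is what [extend_colour]
    relies on. *)
Definition solvable_table : bool :=
  all (fun w => has (fun k => compat w k w k) colours3
             && has (fun k => ~~ compat w k w k) colours3) (iota 0 n).

(** By induction on v, the entries along a proper colouring f are all true: f w itself is the
    witness when w is eliminated. *)
Lemma compat_complete (f : nat -> nat) :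
  (forall u, u < n -> f u < 3 /\ U u (f u)) ->
  (forall u v, u < n -> v < n -> A u v -> f u != f v) ->
  (forall u, u < n -> has (fun k => ~~ U u k) colours3) ->
  solvable_table.
Proof.
move=> Hf HA HU.
have f3 u : u < n -> f u \in colours3.
  by move=> /Hf[]; rewrite !inE; case: (f u) => [|[|[|]]].
have H v u : v <= u -> u < n -> compat u (f u) v (f v).
  elim/ltn_ind: v u => v IHv u vu un; rewrite compatE.
  rewrite (proj2 (Hf u un)) andTb; apply/andP; split.
    case: ifP => [/eqP E|]; last by apply: contraFN => /eqP->.
    by apply/negP => /(HA _ _ un (leq_ltn_trans vu un)); rewrite E eqxx.
  apply/allP => w; rewrite mem_iota => wv; cbv beta.
  by apply/hasP; exists (f w); [apply: f3|rewrite !IHv]; lia.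
apply/allP => w; rewrite mem_iota => /andP[_ wn]; apply/andP; split.
  by apply/hasP; exists (f w); rewrite ?f3 ?H.
have /hasP[k k3 Uk] := HU w wn.
by apply/hasP; exists k => //; rewrite compatE (negbTE Uk).
Qed.

(* A vertex with at most two available colours behaves like a Helly family:
   if each of its colours is spoiled by some later vertex, then some pair of
   later vertices spoils both. *)
Lemma extend_colour (f : nat -> nat) (w : nat) : solvable_table -> w < n ->
  (forall u v, w < v -> v <= u -> u < n -> compat u (f u) v (f v)) ->
  exists k, [/\ k \in colours3, compat w k w k &
                forall u, w < u < n -> compat u (f u) w k].
Proof.
move=> /allP/(_ w); rewrite mem_iota => Hw wn Hf.
have /andP[/hasP[k1 k1c Pk1] /hasP[k0 k0c Pk0]] := Hw wn.
(* The entry of two later vertices records that some colour of w suits both. *)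
have pair u v : w < u < n -> w < v < n -> exists2 k, k \in colours3 &
    [/\ compat w k w k, compat u (f u) w k & compat v (f v) w k].
  have ord u' v' : w < u' < n -> w < v' < n -> v' <= u' -> exists2 k, k \in colours3 &
      [/\ compat w k w k, compat u' (f u') w k & compat v' (f v') w k].
    move=> Hu Hv vu.
    have : compat u' (f u') v' (f v') by apply: Hf; lia.
    rewrite compatE => /and3P[_ _ /allP/(_ w)].
    rewrite mem_iota => /(_ ltac:(lia)) /hasP[k kc /and3P[]].
    by exists k.
  move=> Hu Hv; case: (leqP v u) => [|/ltnW] vu; first exact: ord.
  by have [k kc []] := ord v u Hv Hu vu; exists k.
have [k2 Hk2] : exists k2, forall k, k \in colours3 -> [|| k == k0, k == k1 | k == k2].
  have nk : k0 != k1 by apply: contraNneq Pk0 => ->.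
  (* The three colours sum to 3, so this is the remaining one. *)
  exists (3 - k0 - k1); move: k0c k1c nk; rewrite !inE => + + + k; rewrite inE => + + + k3.
  by do ![case/or3P=> /eqP-> //=] => _; move: k3; rewrite !inE => /or3P[]/eqP->.
pose good k := [&& compat w k w k & all (fun u => compat u (f u) w k) (iota w.+1 (n - w.+1))].
have goodP k : k \in colours3 -> good k -> exists k, [/\ k \in colours3, compat w k w k &
                forall u, w < u < n -> compat u (f u) w k].
  move=> kc /andP[Pk /allP Hk]; exists k; split=> // u Hu; apply: Hk.
  by rewrite mem_iota; lia.
have badP k : compat w k w k -> ~~ good k -> exists2 u, w < u < n & ~~ compat u (f u) w k.
  move=> Pk; rewrite /good Pk /= => /allPn[u]; rewrite mem_iota => Hu nu.
  by exists u => //; lia.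
(* Only k1 and k2 are candidates. If u1 spoils k1 and u2 spoils k2, no colour suits both u1 and u2,
   against [pair]. *)
case Gk1 : (good k1); first exact: goodP Gk1.
have [u1 Hu1 nu1] := badP _ Pk1 (negbT Gk1).
have [k kc [Pk Ck _]] := pair u1 u1 Hu1 Hu1.
have kk2 : k = k2.
  case/or3P: (Hk2 k kc) => /eqP // E; first by rewrite -E Pk in Pk0.
  by rewrite -E Ck in nu1.
case Gk : (good k); first exact: goodP Gk.
have [u2 Hu2 nu2] := badP _ Pk (negbT Gk).
have [k' kc' [Pk' C1 C2]] := pair u1 u2 Hu1 Hu2.
case/or3P: (Hk2 k' kc') => /eqP E; first by rewrite -E Pk' in Pk0.
  by rewrite -E C1 in nu1.
by rewrite kk2 -E C2 in nu2.
Qed.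

(** Back-substitution: vertices are coloured from n - 1 down to 0, the reverse of the elimination
    order, each time by [extend_colour]. *)
Lemma compat_sound : solvable_table ->
  exists f : nat -> nat,
    (forall u, u < n -> f u \in colours3 /\ U u (f u)) /\
    (forall u v, v < u -> u < n -> A u v -> f u != f v).
Proof.
move=> H.
have [f [fc Hf]] : exists f : nat -> nat, (forall u, u < n -> f u \in colours3) /\
    forall u v, v <= u -> u < n -> compat u (f u) v (f v).
  suff Hm m : m <= n -> exists f : nat -> nat, (forall u, n - m <= u < n -> f u \in colours3) /\
      forall u v, n - m <= v -> v <= u -> u < n -> compat u (f u) v (f v).
    have [f [fc Hf]] := Hm n (leqnn n); exists f; rewrite subnn in fc Hf.
    by split=> *; [apply: fc | apply: Hf].
  elim: m => [|m IHm] mn; first by exists id; split=> *; lia.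
  have [f [fc Hf]] := IHm (ltnW mn).
  pose w := n - m.+1.
  have [||k [kc Pk Hk]] := @extend_colour f w H; first by rewrite /w; lia.
    by move=> u v wv vu un; apply: Hf => //; rewrite /w in wv; lia.
  exists (fun u => if u == w then k else f u); split=> [u Hu|u v Hv vu un].
    by case: eqP => // uw; apply: fc; rewrite /w in uw; lia.
  case: (eqVneq u w) => [uw|uw]; case: (eqVneq v w) => [vw|vw] //.
  - by rewrite uw vw.
  - by rewrite uw /w in vu *; rewrite /w in vw; lia.
  - by rewrite vw; apply: Hk; rewrite /w in uw vw Hv *; lia.
  - by apply: Hf => //; rewrite /w in vw Hv; lia.
exists f; split=> [u un|u v vu un Auv].
  by split; [apply: fc|have := Hf u u (leqnn u) un; rewrite compatE => /and3P[]].
have := Hf u v (ltnW vu) un; rewrite compatE => /and3P[_ + _].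
by case: eqP => //; rewrite Auv.
Qed.

End Elimination.

(** * The program *)

(** Truth values are numbers, with positive meaning true: addition is disjunction and [Sum] is
    existential quantification over the vertices. *)
Definition not_ (e : expr) := Minus (Cst 1) e.
Definition and_ (a b : expr) := not_ (Plus (not_ a) (not_ b)).
Definition has3 (f : nat -> expr) := Plus (f 0) (Plus (f 1) (f 2)).
Definition all_lt_size (e : expr) := not_ (Sum (not_ e)).
Definition triple (e : expr) := Plus e (Plus e e).
Definition seq3 (f : nat -> stmt) := Seq (f 0) (Seq (f 1) (f 2)).

Section Truth.
Variables (m : nat -> nat) (rho : seq nat).
Notation T e := (0 < eval m rho e).

Lemma truth_not e : T (not_ e) = ~~ T e.
Proof. by rewrite /=; case: (eval m rho e). Qed.

Lemma truth_and a b : T (and_ a b) = T a && T b.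
Proof. by rewrite /=; case: (eval m rho a); case: (eval m rho b). Qed.

Lemma truth_or a b : T (Plus a b) = T a || T b.
Proof. by rewrite /= addn_gt0. Qed.

Lemma truth_has3 f : T (has3 f) = has (fun k => T (f k)) colours3.
Proof. by rewrite !truth_or /= orbF. Qed.

Lemma truth_all e : T (all_lt_size e) =
  all (fun k => 0 < eval m (rcons rho k) e) (iota 0 (nth 0 rho 0)).
Proof.
rewrite truth_not -eqn0Ngt /= sum_nat_seq_eq0 /index_iota subn0.
by apply: eq_all => k /=; case: (eval m _ e).
Qed.
End Truth.

(* [input_end n] is the length of the input.  The cell at this address counts
   the successful guesses, and the table of [compat] is stored after it. *)
Definition input_end (n : nat) := 1 + n + (n * n + 3 * n).
Definition cell (n u i v j : nat) := input_end n + 1 + (9 * (n * u + v) + (3 * i + j)).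

(** [Sum (Var a)] is n times the value at level a, the offset of a row of the adjacency matrix. *)
Definition adj_expr (a b : nat) : expr :=
  Read (Plus (Plus (Cst 1) (Var 0)) (Plus (Sum (Var a)) (Var b))).
Definition list_expr (a i : nat) : expr :=
  Read (Plus (Plus (Cst 1) (Var 0)) (Plus (Sum (Var 0)) (Plus (triple (Var a)) (Cst i)))).
Definition end_expr : expr :=
  Plus (Plus (Cst 1) (Var 0)) (Plus (Sum (Var 0)) (triple (Var 0))).
Definition cell_expr (a i b j : nat) : expr :=
  Plus (Plus end_expr (Cst 1))
       (Plus (triple (triple (Plus (Sum (Var a)) (Var b)))) (Cst (3 * i + j))).

Definition unary_expr (gs : seq (nat * nat)) (a i : nat) : expr :=
  and_ (list_expr a i)
       (not_ (foldr (fun g e => if g.2 == i then Plus (adj_expr a g.1) e else e)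
                    (Cst 0) gs)).

(** Level d is the variable bound by [all_lt_size]. It runs over all vertices; the disjunct
    [not_ (Minus (Var b) (Var d))] restricts it to those below the vertex at level b. The two
    truncated differences add up to a positive number exactly when the vertices differ. *)
Definition entry_expr (gs : seq (nat * nat)) (d a i b j : nat) : expr :=
  and_ (unary_expr gs a i)
 (and_ (if i == j then not_ (adj_expr a b)
        else Plus (Minus (Var a) (Var b)) (Minus (Var b) (Var a)))
       (all_lt_size
          (Plus (not_ (Minus (Var b) (Var d)))
                (has3 (fun k => and_ (Read (cell_expr a i d k))
                                (and_ (Read (cell_expr b j d k))
                                      (Read (cell_expr d k d k)))))))).

(* The entries with v > u are computed as well, but they are never read. *)
Definition block_stmt (gs : seq (nat * nat)) (a b d : nat) : stmt :=
  seq3 (fun i => seq3 (fun j => Store (cell_expr a i b j) (entry_expr gs d a i b j))).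

(** The order of the loops matters: for v <= u the entry (u, v) uses only (u, w), (v, w) and (w, w)
    with w < v, all stored earlier. *)
Definition table_stmt (gs : seq (nat * nat)) (d : nat) : stmt :=
  For (For (block_stmt gs d d.+1 d.+2)).

Definition check_expr (d : nat) : expr :=
  all_lt_size (and_ (has3 (fun k => Read (cell_expr d k d k)))
                    (has3 (fun k => not_ (Read (cell_expr d k d k))))).

(* [gs] lists the guesses so far: the level of a vertex variable and the colour
   of that vertex. *)
Fixpoint guess_stmt (k : nat) (gs : seq (nat * nat)) (d : nat) : stmt :=
  if k is k'.+1 then For (seq3 (fun c => guess_stmt k' ((d, c) :: gs) d.+1))
  else Seq (table_stmt gs d) (Store end_expr (Plus (Read end_expr) (check_expr d))).

Section Algorithm.
Variables (n : nat) (A L : nat -> nat -> bool).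

Definition reads_input (m : nat -> nat) : Prop :=
  (forall u v, u < n -> v < n -> (0 < m (1 + n + (n * u + v))) = A u v) /\
  (forall u i, u < n -> i < 3 -> (0 < m (1 + n + (n * n + (3 * u + i)))) = L u i).

Definition allowed (h : seq (nat * nat)) (u i : nat) : bool :=
  L u i && ~~ has (fun g => (g.2 == i) && A u g.1) h.

Definition env_ok (rho : seq nat) := (nth 0 rho 0 == n) && (0 < size rho).

Definition values (rho : seq nat) (gs : seq (nat * nat)) : seq (nat * nat) :=
  [seq (nth 0 rho g.1, g.2) | g <- gs].

Definition guesses_ok (rho : seq nat) (gs : seq (nat * nat)) :=
  all (fun g => (g.1 < size rho) && (nth 0 rho g.1 < n)) gs.

Lemma env_rcons rho k : env_ok rho -> env_ok (rcons rho k).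
Proof. by case/andP=> E s; rewrite /env_ok size_rcons nth_rcons s E. Qed.

Lemma eval_mul m rho a : env_ok rho -> a < size rho ->
  eval m rho (Sum (Var a)) = n * nth 0 rho a.
Proof.
case/andP=> /eqP E s lt_a; rewrite /= E.
under eq_bigr do rewrite nth_rcons lt_a.
by rewrite sum_nat_const_nat subn0.
Qed.

Lemma den_store m rho a b : den rho (Store a b) m = upd m (eval m rho a) (eval m rho b).
Proof. by []. Qed.

Lemma den_seq m rho s1 s2 : den rho (Seq s1 s2) m = den rho s2 (den rho s1 m).
Proof. by []. Qed.

Lemma den_for m rho s : den rho (For s) m =
  foldl (fun m k => den (rcons rho k) s m) m (iota 0 (nth 0 rho 0)).
Proof. by []. Qed.

Lemma evalD m rho a b : eval m rho (Plus a b) = eval m rho a + eval m rho b.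
Proof. by []. Qed.

Lemma evalL m rho a : eval m rho (Read a) = m (eval m rho a).
Proof. by []. Qed.

Lemma eval_triple m rho e : eval m rho (triple e) = 3 * eval m rho e.
Proof. by rewrite /triple !evalD !mulSn addn0. Qed.

Lemma eval_end m rho : env_ok rho -> eval m rho end_expr = input_end n.
Proof.
move=> ok; have /andP[/eqP E s] := ok.
by rewrite /end_expr evalD [eval m rho (Plus (Sum _) _)]evalD eval_mul //= E /input_end; lia.
Qed.

Lemma eval_cell m rho a i b j : env_ok rho -> a < size rho ->
  eval m rho (cell_expr a i b j) = cell n (nth 0 rho a) i (nth 0 rho b) j.
Proof.
move=> ok lt_a.
rewrite /cell_expr evalD [eval _ _ (Plus end_expr _)]evalD eval_end //.
rewrite [X in _ + X]evalD !eval_triple [eval _ _ (Plus (Sum _) _)]evalD eval_mul //=.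
by rewrite mulnA.
Qed.

Lemma truth_adj m rho a b : reads_input m -> env_ok rho -> a < size rho ->
  nth 0 rho a < n -> nth 0 rho b < n ->
  (0 < eval m rho (adj_expr a b)) = A (nth 0 rho a) (nth 0 rho b).
Proof.
move=> [Hm _] ok lt_a an bn; have /andP[/eqP E s] := ok.
rewrite -Hm // /adj_expr evalL !evalD eval_mul //= E; congr (0 < m _); lia.
Qed.

Lemma truth_list m rho a i : reads_input m -> env_ok rho -> a < size rho ->
  nth 0 rho a < n -> i < 3 ->
  (0 < eval m rho (list_expr a i)) = L (nth 0 rho a) i.
Proof.
move=> [_ Hm] ok lt_a an i3; have /andP[/eqP E s] := ok.
rewrite -Hm // /list_expr evalL !evalD eval_mul //= E; congr (0 < m _); lia.
Qed.

Lemma truth_unary m rho gs a i : reads_input m -> env_ok rho -> a < size rho ->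
  nth 0 rho a < n -> i < 3 -> guesses_ok rho gs ->
  (0 < eval m rho (unary_expr gs a i)) = allowed (values rho gs) (nth 0 rho a) i.
Proof.
move=> Hm ok lt_a an i3 gok.
rewrite truth_and truth_not truth_list // /allowed; congr (_ && ~~ _).
elim: gs gok => //= g gs IH /andP[/andP[_ gn] gok].
case: eqP => _ /=; last exact: IH.
by rewrite addn_gt0 IH // truth_adj.
Qed.

Section Table.
Variable h : seq (nat * nat).
Notation F := (compat (allowed h) A).

Definition correct (m : nat -> nat) (u v : nat) : Prop :=
  forall i j, i < 3 -> j < 3 -> (0 < m (cell n u i v j)) = F u i v j.

Lemma truth_entry m rho gs d a i b j :
  reads_input m -> env_ok rho -> guesses_ok rho gs -> values rho gs = h ->
  d = size rho -> a < d -> b < d -> nth 0 rho a < n -> nth 0 rho b < n ->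
  i < 3 -> j < 3 ->
  (forall w, w < nth 0 rho b -> [/\ correct m (nth 0 rho a) w,
                                  correct m (nth 0 rho b) w & correct m w w]) ->
  (0 < eval m rho (entry_expr gs d a i b j)) = F (nth 0 rho a) i (nth 0 rho b) j.
Proof.
move=> Hm ok gok hE dE ad bd an bn i3 j3 Hlow.
rewrite compatE /entry_expr truth_and (truth_unary Hm ok) -?dE // hE truth_and; congr [&& _, _ & _].
  case: eqP => _; first by rewrite truth_not truth_adj -?dE.
  by rewrite /= addn_gt0 !subn_gt0 -neq_ltn eq_sym.
have /andP[/eqP E s] := ok.
rewrite truth_all E.
(* From the vertex at level b onwards the quantified formula is trivially true. *)
have -> : iota 0 n = iota 0 (nth 0 rho b) ++ iota (nth 0 rho b) (n - nth 0 rho b).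
  by rewrite -{1}(subnKC (ltnW bn)) iotaD.
rewrite all_cat; set X := all _ (iota (nth 0 rho b) _).
have nthr k c : c < d -> nth 0 (rcons rho k) c = nth 0 rho c.
  by rewrite dE nth_rcons => ->.
have nthd k : nth 0 (rcons rho k) d = k by rewrite nth_rcons dE ltnn eqxx.
have -> : X = true.
  apply/allP => k; rewrite mem_iota => /andP[bk _].
  rewrite truth_or truth_not /= nthd nthr //.
  by rewrite subn_gt0 -leqNgt bk.
rewrite andbT; apply: eq_in_all => w; rewrite mem_iota => /andP[_ wb].
rewrite truth_or truth_not [eval _ _ (Minus _ _)]/= nthd nthr // subn_gt0 wb orFb.
rewrite truth_has3; have [C1 C2 C3] := Hlow w wb.
have ok' := env_rcons w ok.
have sz : size (rcons rho w) = d.+1 by rewrite size_rcons dE.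
apply: eq_in_has => k k3; have {k3}k3 : k < 3 by move: k3; rewrite !inE; lia.
rewrite !truth_and.
have V c x y : c < d.+1 -> eval m (rcons rho w) (Read (cell_expr c x d y))
   = m (cell n (nth 0 (rcons rho w) c) x w y).
  by move=> lc; rewrite evalL (eval_cell _ _ _ _ ok') ?sz // nthd.
by rewrite !V ?ltnS ?(ltnW ad) ?(ltnW bd) // nthd !nthr // C1 // C2 // C3.
Qed.

Lemma correct_eq m m' u v :
  (forall i j, i < 3 -> j < 3 -> m' (cell n u i v j) = m (cell n u i v j)) ->
  correct m u v -> correct m' u v.
Proof. by move=> E C i j i3 j3; rewrite E // C. Qed.

(** Mixed-radix digits: 3 * i + j is below 9 and v is below n. *)
Lemma cell_inj u i v j u' i' v' j' : v < n -> v' < n -> i < 3 -> i' < 3 -> j < 3 -> j' < 3 ->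
  cell n u i v j = cell n u' i' v' j' -> [/\ u = u', i = i', v = v' & j = j'].
Proof.
move=> vn vn' i3 i3' j3 j3' /addnI E.
have [E1 E2] : n * u + v = n * u' + v' /\ 3 * i + j = 3 * i' + j' by lia.
have uu' : u = u'.
  have n0 : 0 < n by lia.
  by move: (congr1 (divn^~ n) E1); rewrite ![n * _]mulnC !divnMDl // !divn_small // !addn0.
by move: E1; rewrite uu' => /addnI->; split=> //; lia.
Qed.

Lemma reads_input_eq m m' : (forall x, x < input_end n -> m' x = m x) ->
  reads_input m -> reads_input m'.
Proof.
move=> E [H1 H2]; split=> u v un vn; rewrite E.
- exact: H1.
- have : n * u.+1 <= n * n by rewrite leq_mul2l un orbT.
  by rewrite mulnS /input_end; lia.
- exact: H2.
- by rewrite /input_end; lia.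
Qed.

Lemma seq3_ind (rho : seq nat) (f : nat -> stmt) (I : nat -> (nat -> nat) -> Prop) m :
  I 0 m -> (forall k m, k < 3 -> I k m -> I k.+1 (den rho (f k) m)) ->
  I 3 (den rho (seq3 f) m).
Proof. by move=> I0 IS; apply: (IS 2) => //; apply: (IS 1) => //; apply: (IS 0). Qed.

Lemma foldl_iota_ind (T : Type) (f : T -> nat -> T) (I : nat -> T -> Prop) k x :
  I 0 x -> (forall j y, j < k -> I j y -> I j.+1 (f y j)) -> I k (foldl f x (iota 0 k)).
Proof.
move=> I0; elim: k => [//|k IHk] IS.
rewrite -[k.+1]addn1 iotaD foldl_cat /= addn1; apply: (IS) => //.
by apply: IHk => j y /ltnW; apply: IS.
Qed.

Lemma block_ok m rho gs d a b (u := nth 0 rho a) (v := nth 0 rho b) :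
  reads_input m -> env_ok rho -> guesses_ok rho gs -> values rho gs = h ->
  d = size rho -> a < d -> b < d -> u < n -> v < n ->
  let m' := den rho (block_stmt gs a b d) m in
  (forall x, (forall i j, i < 3 -> j < 3 -> x != cell n u i v j) -> m' x = m x) /\
  (v <= u -> (forall w, w < v -> [/\ correct m u w, correct m v w & correct m w w]) ->
     correct m' u v).
Proof.
move=> Hm ok gok hE dE ad bd un vn m'.
(* c counts the colour pairs already stored, in the order of 3 * i + j. *)
pose I c m0 := (forall x, (forall i j, i < 3 -> j < 3 -> x != cell n u i v j) -> m0 x = m x) /\
  (v <= u -> (forall w, w < v -> [/\ correct m u w, correct m v w & correct m w w]) ->
     forall i j, i < 3 -> j < 3 -> 3 * i + j < c -> (0 < m0 (cell n u i v j)) = F u i v j).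
suff [H1 H2] : I 9 m'.
  by split=> // vu Hw i j i3 j3; apply: H2 => //; lia.
apply: (@seq3_ind rho _ (fun i => I (3 * i))) => [|i m1 i3 I1]; first by split.
have -> : 3 * i.+1 = 3 * i + 3 by lia.
apply: (@seq3_ind rho _ (fun j => I (3 * i + j))) => [|j m2 j3 [H1 H2]]; first by rewrite addn0.
rewrite den_store eval_cell // -?dE //; split=> [x Hx|vu Hw i' j' i3' j3' lt_c].
  by rewrite updE (negbTE (Hx i j i3 j3)) H1.
rewrite updE; case: eqP => [/(cell_inj vn vn i3' i3 j3' j3)[_ -> _ ->]|neq]; last first.
  apply: H2 => //; suff : 3 * i' + j' != 3 * i + j by lia.
  by apply/eqP => E; apply: neq; rewrite /cell E.
rewrite (truth_entry _ ok gok hE dE) //.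
  apply: reads_input_eq Hm => x xi; apply: H1 => i0 j0 _ _.
  by rewrite /cell; lia.
move=> w wv; have [C1 C2 C3] := Hw w wv.
(* The stores for (u, v) leave the columns w < v untouched, so the entries that are read keep their
   values. *)
have far c i1 j1 : i1 < 3 -> j1 < 3 ->
    m2 (cell n c i1 w j1) = m (cell n c i1 w j1).
  move=> i13 j13; apply: H1 => i0 j0 i03 j03; apply/eqP => /cell_inj[] //.
    exact: ltn_trans wv vn.
  by move=> _ _ wE _; rewrite wE ltnn in wv.
by split; [apply: correct_eq C1|apply: correct_eq C2|apply: correct_eq C3]; move=> *; apply: far.
Qed.

Lemma table_ok m rho gs d :
  reads_input m -> env_ok rho -> guesses_ok rho gs -> values rho gs = h -> d = size rho ->
  let m' := den rho (table_stmt gs d) m in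
  (forall x, x <= input_end n -> m' x = m x) /\
  (forall u v, v <= u -> u < n -> correct m' u v).
Proof.
move=> Hm ok gok hE dE m'; have /andP[/eqP En s0] := ok.
(* Lexicographic invariant: the entries before (k, l) are correct. The bound [x <= input_end n]
   includes the counter cell, which the table must not overwrite. *)
pose I k l m0 := (forall x, x <= input_end n -> m0 x = m x) /\
  (forall u v, v <= u -> u < n -> u < k \/ u = k /\ v < l -> correct m0 u v).
suff [H1 H2] : I n 0 m' by split=> // u v vu un; apply: H2 => //; left.
rewrite /m' /table_stmt den_for En; apply: (@foldl_iota_ind _ _ (fun k => I k 0)).
  by split=> // u v _ _ [//|[_]].
move=> u m1 un I1; rewrite den_for nth_rcons s0 En; suff [H1 H2] : I u n (foldl (fun m0 k => den (rcons (rcons rho u) k)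
    (block_stmt gs d d.+1 d.+2) m0) m1 (iota 0 n)).
  split=> // u' v' vu' un' H.
  by apply: H2 => //; lia.
apply: (@foldl_iota_ind _ _ (I u)) => // v m2 vn [H1 H2].
set rho' := rcons _ v.
have ok' : env_ok rho' by do 2!apply: env_rcons.
have sz : d.+2 = size rho' by rewrite !size_rcons dE.
have nth_lt c : c < d -> nth 0 rho' c = nth 0 rho c.
  by move=> cd; rewrite !nth_rcons size_rcons -dE ltnS (ltnW cd) cd.
have gok' : guesses_ok rho' gs.
  apply: sub_all gok => g /andP[g1 g2]; rewrite -dE in g1.
  by rewrite -sz nth_lt // g2 andbT; lia.
have hE' : values rho' gs = h.
  rewrite -hE; apply/eq_in_map => g /(allP gok)/andP[g1 _].
  by rewrite nth_lt ?dE.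
have uE : nth 0 rho' d = u by rewrite !nth_rcons size_rcons -dE ltnSn ltnn eqxx.
have vE : nth 0 rho' d.+1 = v by rewrite nth_rcons size_rcons -dE ltnn eqxx.
have Hm2 : reads_input m2 by apply: reads_input_eq Hm => x /ltnW; apply: H1.
have := @block_ok m2 rho' gs d.+2 d d.+1 Hm2 ok' gok' hE' sz (ltnW (ltnSn _)) (ltnSn _).
rewrite uE vE => /(_ un vn)[B1 B2]; split=> [x xi|u' v' vu' un' lt'].
  by rewrite B1 ?H1 // => i j _ _; rewrite /cell; lia.
have [/eqP[uu vv]|neq] := boolP ((u', v') == (u, v)).
  rewrite uu vv; apply: B2; first by rewrite -uu -vv.
  by move=> w wv; split; apply: H2; lia.
apply: (@correct_eq m2); last first.
  by apply: H2 => //; move: neq; rewrite xpair_eqE; lia.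
move=> i j i3 j3; apply: B1 => i0 j0 i03 j03; apply: contraNneq neq.
have vn' : v' < n by apply: leq_ltn_trans un'.
by case/(cell_inj vn' vn i3 i03 j3 j03) => -> _ -> _.
Qed.

Lemma truth_check m rho d : env_ok rho -> d = size rho ->
  (forall u v, v <= u -> u < n -> correct m u v) ->
  (0 < eval m rho (check_expr d)) = solvable_table n (allowed h) A.
Proof.
move=> ok dE C; have /andP[/eqP En s0] := ok.
rewrite truth_all En; apply: eq_in_all => w; rewrite mem_iota => /andP[_ wn].
have ok' := env_rcons w ok.
have V k : k \in colours3 ->
    (0 < eval m (rcons rho w) (Read (cell_expr d k d k))) = F w k w k.
  move=> kc; have k3 : k < 3 by move: kc; rewrite !inE; lia.
  rewrite evalL eval_cell ?size_rcons ?dE // nth_rcons ltnn eqxx.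
  exact: C.
rewrite truth_and !truth_has3; congr (_ && _); apply: eq_in_has => k kc.
  by rewrite V.
by rewrite truth_not V.
Qed.
End Table.

Lemma values_rcons rho gs k : guesses_ok rho gs -> values (rcons rho k) gs = values rho gs.
Proof.
move=> gok; apply/eq_in_map => g /(allP gok)/andP[g1 _].
by rewrite nth_rcons g1.
Qed.

(** The counter never decreases, so it ends positive iff it was positive or some completion h of the
    guesses passes the check. In h the outermost guess comes first, in [gs] the innermost, hence
    [catrev]. *)
Lemma guess_ok k gs d rho m :
  reads_input m -> env_ok rho -> guesses_ok rho gs -> d = size rho ->
  let m' := den rho (guess_stmt k gs d) m in
  (forall x, x < input_end n -> m' x = m x) /\
  (0 < m' (input_end n) <-> 0 < m (input_end n) \/
     exists h, [/\ size h = k, all (fun g => (g.1 < n) && (g.2 < 3)) h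
                & solvable_table n (allowed (catrev h (values rho gs))) A]).
Proof.
elim: k gs d rho m => [|k IHk] gs d rho m Hm ok gok dE m'; have /andP[/eqP En s0] := ok.
  have [T1 T2] := table_ok Hm ok gok erefl dE.
  rewrite /m' [guess_stmt _ _ _]/= den_seq den_store evalD evalL !eval_end //.
  set m1 := den rho (table_stmt gs d) m in T1 T2 *.
  split=> [x xi|]; first by rewrite updE ltn_eqF // T1 // ltnW.
  rewrite updE eqxx addn_gt0 T1 // (truth_check ok dE T2).
  split=> [/orP[|H]|[->//|[h [/size0nil-> _ ->]]]]; rewrite ?orbT //; first by left.
  by right; exists [::].
(* The next guesses tried so far are the pairs lexicographically before (s, c). *)
pose I s c m0 := (forall x, x < input_end n -> m0 x = m x) /\
  (0 < m0 (input_end n) <-> 0 < m (input_end n) \/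
     exists s' c' h, [/\ (s' < s) || (s' == s) && (c' < c), (s' < n) && (c' < 3), size h = k,
                      all (fun g => (g.1 < n) && (g.2 < 3)) h
                & solvable_table n (allowed (catrev h ((s', c') :: values rho gs))) A]).
suff [H1 H2] : I n 0 m'.
  split=> //; rewrite H2; split=> -[|]; try by left.
    move=> [s' [c' [h [_ sc hk hall hs]]]]; right; exists ((s', c') :: h).
    by rewrite /= hk sc hall.
  move=> [[|[s' c'] h] [//= [hk] /andP[sc hall] hs]]; right.
  by exists s', c', h; case/andP: (sc) => ->.
rewrite /m' [guess_stmt _ _ _]/= den_for En.
apply: (@foldl_iota_ind _ _ (fun s => I s 0)).
  split=> //; split=> [|[//|]]; first by left.
  by move=> [s' [c' [h [+ _ _ _ _]]]]; rewrite !ltn0 andbF.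
move=> s m1 sn I1.
suff [H1 H2] : I s 3 (den (rcons rho s) (seq3 (fun c => guess_stmt k ((d, c) :: gs) d.+1)) m1).
  split=> //; rewrite H2; split=> -[|]; try (by left);
    move=> [s' [c' [h [lt_s sc hk hall hs]]]]; right; exists s', c', h; split=> //.
    by move: lt_s; lia.
  by move: lt_s; lia.
apply: (@seq3_ind (rcons rho s) _ (I s)) => // c m2 c3 [H1 H2].
have ok' := env_rcons s ok.
have dE' : d.+1 = size (rcons rho s) by rewrite size_rcons dE.
have gok' : guesses_ok (rcons rho s) ((d, c) :: gs).
  rewrite /= -dE' ltnSn nth_rcons dE ltnn eqxx sn /=.
  apply: sub_all gok => g /andP[g1 g2].
  by rewrite nth_rcons g1 g2 andbT; lia.
have [B1 B2] := IHk _ _ _ m2 (reads_input_eq H1 Hm) ok' gok' dE'.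
have vE : values (rcons rho s) ((d, c) :: gs) = (s, c) :: values rho gs.
  by rewrite /= nth_rcons dE ltnn eqxx -(values_rcons s gok).
rewrite vE in B2; split=> [x xi|]; first by rewrite B1 // H1.
rewrite B2 H2; split=> [[[|]|]|[|]]; try by [left|left; left].
- move=> [s' [c' [h [lt_s sc hk hall hs]]]]; right; exists s', c', h; split=> //; lia.
- by move=> [h [hk hall hs]]; right; exists s, c, h; split=> //; lia.
- move=> [s' [c' [h [lt_s sc hk hall hs]]]].
  have [/eqP[<- <-]|neq] := boolP ((s', c') == (s, c)); first by right; exists h.
  left; right; exists s', c', h; split=> //.
  by move: lt_s neq; rewrite xpair_eqE; lia.
Qed.
End Algorithm.

(** * Positions in the encoded instance *)

Lemma nth_allpairs (S T R : Type) (f : S -> T -> R) s t x0 y0 z0 i j :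
  i < size s -> j < size t ->
  nth z0 [seq f x y | x <- s, y <- t] (size t * i + j) = f (nth x0 s i) (nth y0 t j).
Proof.
move=> + jt; elim: s i => [//|x s IHs] [|i] /= lt_i; rewrite nth_cat size_map.
  by rewrite muln0 jt (nth_map y0).
by rewrite mulnS -addnA ltnNge leq_addr /= addKn IHs.
Qed.

Section Encoding.
Variable x : l3c_instance.
Notation G := (l3c_graph x).
Notation n := (Defs.order G).

Lemma size_l3c_encode : size (l3c_encode x) = input_end n.
Proof.
by rewrite /l3c_encode !size_cat size_nseq !size_allpairs size_enum_ord /input_end /=; lia.
Qed.

Lemma nth_encode_adj (u v : 'I_n) : nth false (l3c_encode x) (1 + n + (n * u + v)) = adj u v.
Proof.
have un := ltn_ord u; have vn := ltn_ord v.
have lt_uv : n * u + v < n * n.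
  have : n * u.+1 <= n * n by rewrite leq_mul2l un orbT.
  by rewrite mulnS; lia.
rewrite /l3c_encode nth_cat size_nseq ltnNge; have -> : n <= 1 + n + (n * u + v) by lia.
have -> : 1 + n + (n * u + v) - n = (n * u + v).+1 by lia.
rewrite /= nth_cat size_allpairs size_enum_ord lt_uv.
have := @nth_allpairs _ _ _ (@adj G) (enum 'I_n) (enum 'I_n) u u false u v.
by rewrite size_enum_ord !nth_ord_enum => ->.
Qed.

Lemma nth_encode_list (u : 'I_n) i : i < 3 ->
  nth false (l3c_encode x) (1 + n + (n * n + (3 * u + i))) = l3c_list u i.+1.
Proof.
move=> i3; have un := ltn_ord u.
rewrite /l3c_encode nth_cat size_nseq ltnNge.
have -> : n <= 1 + n + (n * n + (3 * u + i)) by lia.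
have -> : 1 + n + (n * n + (3 * u + i)) - n = (n * n + (3 * u + i)).+1 by lia.
rewrite /= nth_cat size_allpairs size_enum_ord ltnNge leq_addr addKn /=.
have := @nth_allpairs _ _ _ (@l3c_list x) (enum 'I_n) [:: 1; 2; 3] u 0 false u i.
rewrite size_enum_ord nth_ord_enum => -> //.
by case: i i3 => [|[|[|]]].
Qed.
End Encoding.

(** * From bounded total domination to polynomial time *)

Definition proper3 (G : sgraph) (c : vertex G -> nat) : Prop :=
  (forall u, c u \in [:: 1; 2; 3]) /\ (forall u v, adj u v -> c u <> c v).

(** A guess that passes the check always yields a colouring. Conversely, for a colourable graph,
    guessing its colours on the total dominating set S removes from every vertex the colour of a
    neighbour, so at most two remain. S has exactly M entries, possibly repeated, because the
    program makes exactly M guesses. *)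
Theorem poly_time_of_domination (C : sgraph -> Prop) (M : nat) :
  (forall G (c : vertex G -> nat), C G -> proper3 c ->
     exists2 S : seq (vertex G), size S = M & forall v, exists2 s, s \in S & adj v s) ->
  list_3_colouring_poly_time_on C.
Proof.
move=> dom; apply: (@poly_time_ram _ _ _ _ (guess_stmt M [::] 1) (Read end_expr)) => x Cx.
pose n := Defs.order (l3c_graph x).
pose m i := nat_of_bool (nth false (l3c_encode x) i).
pose A u v := nth false (l3c_encode x) (1 + n + (n * u + v)).
pose L u i := nth false (l3c_encode x) (1 + n + (n * n + (3 * u + i))).
exists n, (behead (drop n (l3c_encode x))) => m'.
have Hm : reads_input n A L m by split=> u v _ _; rewrite /m /A /L; case: nth.
split.
  by rewrite /l3c_encode -/n drop_size_cat ?size_nseq.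
have ok : env_ok n [:: n] by rewrite /env_ok eqxx.
have [_ H] := @guess_ok n A L M [::] 1 [:: n] m Hm ok isT erefl.
rewrite evalL (eval_end _ ok) H.
have -> : m (input_end n) = 0 by rewrite /m nth_default // size_l3c_encode.
split=> [[//|[h [_ _ /compat_sound[f [f1 f2]]]]]|[c [[c1 c2] cL]]].
  (* The table uses the colours 0, 1, 2 for 1, 2, 3. *)
  exists (fun u => (f u).+1); split; first split=> // u v uv.
    wlog vu : u v uv / v < u.
      move=> W; case: (ltngtP u v) => [lt|lt|/val_inj E].
      - by move=> /esym; apply: W; rewrite // adj_sym.
      - exact: W.
      - by rewrite E adj_irr in uv.
    move=> [E]; have := f2 u v vu (ltn_ord u); rewrite /A nth_encode_adj E eqxx.
    by move/(_ uv).
  move=> u; have [f3 /andP[+ _]] := f1 u (ltn_ord u).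
  by rewrite /L nth_encode_list //; move: f3; rewrite !inE; lia.
have c3 u : c u \in [:: 1; 2; 3] by apply: l3c_list_sub (cL u).
have cE u : (c u).-1.+1 = c u by have := c1 u; lia.
have c_lt u : (c u).-1 < 3 by have := c3 u; rewrite !inE; lia.
have [S SM HS] := dom _ c Cx (conj c3 c2).
pose h := [seq (val s, (c s).-1) | s <- S].
right; exists h; rewrite size_map; split=> //.
  by apply/allP => g /mapP[s _ ->] /=; rewrite ltn_ord c_lt.
pose f u := if insub u is Some a then (c a).-1 else 0.
have fE (a : 'I_n) : f a = (c a).-1 by rewrite /f valK.
apply: (@compat_complete _ _ _ f) => [u un|u v un vn|u un].
- rewrite -[u]/(val (Ordinal un)) fE c_lt; split=> //; rewrite /allowed /L nth_encode_list //.
  rewrite cE cL catrevE cats0 has_rev has_map; apply/hasPn => s _ /=.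
  rewrite /A (nth_encode_adj (Ordinal un)); apply/negP => /andP[/eqP E /c2].
  by rewrite -[c (Ordinal un)]cE -E cE.
- rewrite -[u]/(val (Ordinal un)) -[v]/(val (Ordinal vn)) !fE /A nth_encode_adj => /c2 cn.
  by apply/eqP => E; apply: cn; rewrite -[LHS]cE E cE.
(* The colour of a neighbour s in S is the one forbidden at u. *)
have [s sS us] := HS (Ordinal un); apply/hasP; exists (c s).-1.
  by move: (c_lt s); rewrite !inE; lia.
rewrite /allowed negb_and negbK orbC catrevE cats0 has_rev has_map.
apply/orP; left; apply/hasP; exists s => //=.
by rewrite eqxx /A (nth_encode_adj (Ordinal un)).
Qed.

(** * Dominating sets and induced cycles *)

(** A separate target for each colour allows induction on the sum of the targets: split the tail by
    its colour with the head a, and lower the target of that colour by one. *)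
Lemma ramsey3 (K : nat -> nat) : exists R, forall (T : eqType) (col : T -> T -> nat) (s : seq T),
  (forall a b, col a b \in [:: 1; 2; 3]) -> R <= size s ->
  exists g s', [/\ g \in [:: 1; 2; 3], subseq s' s, size s' = K g
                 & pairwise (fun a b => col a b == g) s'].
Proof.
have [N] := ubnP (K 1 + K 2 + K 3); elim: N K => // N IHN K ltN.
have [/hasP[g g3 /eqP Kg]|/hasPn K0] := boolP (has (fun g => K g == 0) [:: 1; 2; 3]).
  by exists 0 => T col s _ _; exists g, [::]; rewrite sub0seq.
have Kpos g : g \in [:: 1; 2; 3] -> 0 < K g by move=> /K0; rewrite lt0n.
have IH g : g \in [:: 1; 2; 3] -> exists R, forall (T : eqType) (col : T -> T -> nat) (s : seq T),
    (forall a b, col a b \in [:: 1; 2; 3]) -> R <= size s ->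
    exists h s', [/\ h \in [:: 1; 2; 3], subseq s' s, size s' = upd K g (K g).-1 h
                   & pairwise (fun a b => col a b == h) s'].
  move=> g3; apply: IHN; have := Kpos _ g3; move: g3 ltN.
  by rewrite !inE => /or3P[]/eqP->; rewrite /upd /=; lia.
have [R1 H1] := IH 1 isT; have [R2 H2] := IH 2 isT; have [R3 H3] := IH 3 isT.
(* Some colour g joins a to at least R_g later elements; the successor accounts for a itself. *)
exists (R1 + R2 + R3).+1 => T col [//|a s] col3 szs.
pose F g := [seq b <- s | col a b == g].
have step g R : g \in [:: 1; 2; 3] -> R <= size (F g) ->
    (forall (T : eqType) (col : T -> T -> nat) (s : seq T),
       (forall a b, col a b \in [:: 1; 2; 3]) -> R <= size s ->
       exists h s', [/\ h \in [:: 1; 2; 3], subseq s' s, size s' = upd K g (K g).-1 h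
                      & pairwise (fun a b => col a b == h) s']) ->
    exists g s', [/\ g \in [:: 1; 2; 3], subseq s' (a :: s), size s' = K g
                   & pairwise (fun a b => col a b == g) s'].
  move=> g3 leR HR; have [h [s' [h3 ss szs' ps]]] := HR T col (F g) col3 leR.
  have ss' := subseq_trans ss (filter_subseq _ _).
  case: (eqVneq h g) => [hg|hg]; last first.
    exists h, s'; split=> //; first exact: subseq_trans ss' (subseq_cons _ _).
    by rewrite szs' /upd (negbTE hg).
  exists h, (a :: s'); split=> //=; first by rewrite eqxx.
    by rewrite szs' /upd hg eqxx prednK // Kpos.
  rewrite ps andbT; apply/allP => b /(mem_subseq ss).
  by rewrite mem_filter hg => /andP[].
have : size s = size (F 1) + size (F 2) + size (F 3).
  rewrite !size_filter; elim: s {szs F step} => //= b s ->.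
  by have := col3 a b; rewrite !inE => /or3P[]/eqP->; lia.
case: (leqP R1 (size (F 1))) => [le1 _|lt1]; first exact: (step 1 R1).
case: (leqP R2 (size (F 2))) => [le2 _|lt2]; first exact: (step 2 R2).
case: (leqP R3 (size (F 3))) => [le3 _|lt3]; first exact: (step 3 R3).
by move: szs => /=; lia.
Qed.

(** * Generic sequences in graphs without induced 4-cycles *)

Section Graph.
Variables (V : finType) (e : rel V) (c : V -> nat).
Hypotheses (e_sym : symmetric e) (e_irr : irreflexive e).
Hypothesis no_C4 : forall x y z t, e x y -> e y z -> e z t -> e t x ->
  x != z -> y != t -> e x z || e y t.
Hypothesis diam2 : forall x y, x != y -> ~~ e x y -> exists z, e x z && e y z.
Hypothesis c3 : forall x, c x \in [:: 1; 2; 3].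
Hypothesis c_proper : forall x y, e x y -> c x != c y.

Lemma same_colour x y : c x = c y -> e x y = false.
Proof. by move=> E; apply/negP => /c_proper; rewrite E eqxx. Qed.

Definition common (x y : V) : seq V :=
  if (x == y) || e x y then [::] else enum [pred z | e x z && e y z].

Lemma mem_common x y z : x != y -> ~~ e x y -> e x z -> e y z -> z \in common x y.
Proof.
by move=> /negbTE xy /negbTE exy xz yz; rewrite /common xy exy mem_enum inE xz yz.
Qed.

(* Two common neighbours of x and y are adjacent, since otherwise they span an
   induced 4-cycle with x and y; so the common neighbours and x have pairwise
   distinct colours. *)
Lemma size_common x y : size (common x y) <= 2.
Proof.
rewrite /common; case: ifP => // /norP[xy exy].
have H z : z \in enum [pred z | e x z && e y z] -> e x z /\ e y z.
  by rewrite mem_enum inE => /andP[].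
suff : size (map c (x :: enum [pred z | e x z && e y z])) <= size [:: 1; 2; 3].
  by rewrite /= size_map.
apply: uniq_leq_size => [|_ /mapP[z _ ->]] //=.
apply/andP; split.
  by apply/mapP => -[z /H[xz _] E]; have := c_proper xz; rewrite E eqxx.
rewrite map_inj_in_uniq ?enum_uniq // => z t /H[xz yz] /H[xt yt] E.
apply/eqP/negPn/negP => zt.
have := @no_C4 x z y t xz; rewrite e_sym yz => /(_ isT yt); rewrite e_sym xt.
by move=> /(_ isT xy zt); rewrite (negbTE exy) (same_colour E).
Qed.

Definition closure (S : seq V) : seq V := S ++ flatten [seq common x y | x <- S, y <- S].

Lemma size_closure S : size (closure S) <= size S + 2 * size S ^ 2.
Proof.
rewrite size_cat leq_add2l size_flatten /shape -mulnn.
set ss := [seq common x y | x <- S, y <- S].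
have -> : size S * size S = size ss by rewrite size_allpairs.
have : all (fun t => size t <= 2) ss.
  by apply/allP => _ /allpairsP[p [_ _ ->]]; apply: size_common.
elim: ss => //= t ss IH /andP[t2 /IH]; rewrite mulnS; exact: leq_add.
Qed.

Lemma sub_closure S : {subset S <= closure S}.
Proof. by move=> x xS; rewrite mem_cat xS. Qed.

Lemma closure_common S x y z : x \in S -> y \in S -> x != y -> ~~ e x y ->
  e x z -> e y z -> z \in closure S.
Proof.
move=> xS yS xy exy xz yz; rewrite mem_cat; apply/orP; right.
apply/flattenP; exists (common x y); last exact: mem_common.
exact: allpairs_f.
Qed.

Lemma closure_mono S S' : {subset S <= S'} -> {subset closure S <= closure S'}.
Proof.
move=> sub x; rewrite !mem_cat => /orP[/sub->//|/flattenP[t /allpairsP[p [p1 p2 ->]] xt]].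
by apply/orP; right; apply/flattenP; exists (common p.1 p.2); rewrite ?allpairs_f ?sub.
Qed.

Definition fresh (S : seq V) (z : V) : bool := all (fun x => (x != z) && ~~ e x z) S.

Lemma fresh_adj S z x : fresh S z -> x \in S -> e x z = false.
Proof. by move=> /allP H /H /andP[_ /negbTE]. Qed.

Lemma fresh_neq S z x : fresh S z -> x \in S -> x != z.
Proof. by move=> /allP H /H /andP[]. Qed.

Lemma fresh_sub S S' z : {subset S <= S'} -> fresh S' z -> fresh S z.
Proof. by move=> sub /allP H; apply/allP => x /sub /H. Qed.

(** A common neighbour of p and q lies in the closure, where z has no neighbour. *)
Lemma fresh_sep S z p q x : fresh (closure S) z -> p \in S -> q \in S -> p != q ->
  e p q = false -> e p x -> e x z -> e x q = false.
Proof.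
move=> fz pS qS pq epq px xz; apply/negP => xq.
have : x \in closure S by apply: (closure_common pS qS pq _ px); rewrite ?epq // e_sym.
by move/(fresh_adj fz); rewrite xz.
Qed.

(* The most recently chosen vertex comes first. *)
Fixpoint generic (s : seq V) : bool :=
  if s is z :: p then fresh (closure (closure (closure p))) z && generic p else true.

Lemma generic_subseq s s' : subseq s' s -> generic s -> generic s'.
Proof.
elim: s s' => [|z p IH] [|z' p'] //= ss /andP[fz gp].
case: eqP ss => [->|_] ss; last exact: (IH (z' :: p')).
rewrite (IH p') // andbT; apply: fresh_sub fz.
by do 3!apply: closure_mono; apply: mem_subseq.
Qed.

(** This reduces non-adjacency claims to cases on the vertex z of s chosen last: the rest of s and
    the older block B precede z, and z is fresh for their closures. *)
Lemma newest q B (s : seq V) : generic (q ++ B) -> {subset s <= q} -> s != [::] ->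
  exists z p, [/\ z \in s, {subset B <= p}, fresh (closure (closure (closure p))) z
                & forall x, x \in s -> x != z -> x \in p].
Proof.
elim: q => [|z q IH] /=; first by case: s => // x s _ /(_ x); rewrite inE eqxx => /(_ isT).
move=> /andP[fz gq] ss s0; have [zs|zs] := boolP (z \in s).
  exists z, (q ++ B); split=> // [x xB|x xs xz]; rewrite mem_cat ?xB ?orbT //.
  by have := ss x xs; rewrite inE (negbTE xz) /= => ->.
apply: IH => // x xs; have := ss x xs; rewrite inE => /orP[/eqP xz|//].
by rewrite -xz xs in zs.
Qed.

Lemma generic_nonadj s a b : generic s -> a \in s -> b \in s -> a != b -> e a b = false.
Proof.
rewrite -[s]cats0 => gs; rewrite cats0 => As Bs ab.
have [||z [p [zs _ fz H]]] := @newest s [::] [:: a; b] gs => //.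
  by move=> x; rewrite !inE => /orP[]/eqP->.
have fp := fresh_sub (@sub_closure _) (fresh_sub (@sub_closure _) (fresh_sub (@sub_closure _) fz)).
move: zs; rewrite !inE => /orP[]/eqP zE; subst z.
  by rewrite e_sym (fresh_adj fp) // H ?inE ?eqxx ?orbT // eq_sym.
by rewrite (fresh_adj fp) // H ?inE ?eqxx.
Qed.

(** If k is newest, x lies in the closure of a and b and cannot be adjacent to k. If a or b is
    newest, an edge from x to k would put x in the closure of the other two. *)
Lemma generic_common s a b k x : generic s -> a \in s -> b \in s -> k \in s ->
  a != b -> a != k -> b != k -> e a x -> e b x -> e x k = false.
Proof.
move=> gs As Bs Ks ab ak bk ax bx; have gs0 : generic (s ++ [::]) by rewrite cats0.
have [||z [p [zs _ fz H]]] := @newest s [::] [:: a; b; k] gs0 => //.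
  by move=> y; rewrite !inE => /or3P[]/eqP->.
have fp := fresh_sub (@sub_closure _) (fresh_sub (@sub_closure _) fz).
have [ab0 ak0 bk0] : [/\ e a b = false, e a k = false & e b k = false].
  by split; apply: (generic_nonadj gs).
move: zs; rewrite !inE => /or3P[]/eqP zE; subst z.
- apply: (fresh_sep fp _ _ bk bk0 bx); rewrite ?(e_sym x) //;
    by apply: H; rewrite ?inE ?eqxx ?orbT // eq_sym.
- apply: (fresh_sep fp _ _ ak ak0 ax); rewrite ?(e_sym x) //;
    by apply: H; rewrite ?inE ?eqxx ?orbT // eq_sym.
- apply: (fresh_adj fp); apply: (closure_common (x := a) (y := b)) => //; rewrite ?ab0 //;
    by apply: H; rewrite ?inE ?eqxx ?orbT.
Qed.

Lemma generic_uniq s : generic s -> uniq s.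
Proof.
elim: s => //= z p IH /andP[fz /IH->]; rewrite andbT; apply/negP => zp.
have := fresh_neq fz (sub_closure (sub_closure (sub_closure zp))).
by rewrite eqxx.
Qed.

Definition mid (x y : V) : V := odflt x [pick z | e x z && e y z].

Lemma midP x y : x != y -> e x y = false -> e x (mid x y) /\ e y (mid x y).
Proof.
move=> xy exy; rewrite /mid; case: pickP => [z /andP[]//|none].
by have [|z] := diam2 xy; rewrite ?exy ?none.
Qed.

(** [pick] depends only on the set of common neighbours, and the asymmetric default is never
    reached. *)
Lemma mid_sym x y : x != y -> e x y = false -> mid x y = mid y x.
Proof.
move=> xy exy; rewrite /mid (eq_pick (Q := [pred z | e y z && e x z])) => [|z]; last first.
  by rewrite /= andbC.
case: pickP => // none; have [|z] := diam2 xy; first by rewrite exy.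
by have := none z; rewrite /= andbC => ->.
Qed.

Fixpoint induced_path (x : V) (s : seq V) : bool :=
  if s is y :: s' then [&& e x y, all (fun z => ~~ e x z) s' & induced_path y s'] else true.

(** The cyclic order is x, y, s, z. Only adjacencies are recorded; from length 5 on they force the
    vertices to be distinct, see [cycle_adj_inj]. *)
Definition induced_cycle (x y : V) (s : seq V) (z : V) : bool :=
  [&& e x y, all (fun t => ~~ e x t) s, e x z & induced_path y (rcons s z)].

Lemma mid_adjl s a b : generic s -> a \in s -> b \in s -> a != b -> e a (mid a b).
Proof. by move=> gs As Bs ab; have [] := midP ab (generic_nonadj gs As Bs ab). Qed.

Lemma mid_adjr s a b : generic s -> a \in s -> b \in s -> a != b -> e (mid a b) b.
Proof. by move=> gs As Bs ab; rewrite e_sym; have [] := midP ab (generic_nonadj gs As Bs ab). Qed.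

Lemma mid_nonadj s a b k : generic s -> a \in s -> b \in s -> k \in s ->
  a != b -> a != k -> b != k -> e (mid a b) k = false.
Proof.
move=> gs As Bs Ks ab ak bk.
apply: (generic_common gs As Bs Ks ab ak bk); first exact: mid_adjl gs As Bs ab.
by rewrite e_sym; apply: mid_adjr gs As Bs ab.
Qed.

(** * Even cycles *)

Section Homogeneous.
Variables (s : seq V) (g : nat).
Hypotheses (gs : generic s)
  (hom : forall a b, a \in s -> b \in s -> a != b -> c (mid a b) = g).

Let N1 a b := @generic_nonadj s a b gs.
Let P1 a b := @mid_adjl s a b gs.
Let P2 a b := @mid_adjr s a b gs.
Let N2 a b k := @mid_nonadj s a b k gs.

Let N3 a b a' b' : a \in s -> b \in s -> a != b -> a' \in s -> b' \in s -> a' != b' ->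
  e (mid a b) (mid a' b') = false.
Proof. by move=> *; rewrite same_colour // !hom. Qed.

Ltac check_edges :=
  rewrite /induced_cycle /=; do ?[apply/andP; split] => //;
  first [ by rewrite N1 | by rewrite N3 | by rewrite N2 | by rewrite e_sym N2
        | by rewrite P1 | by rewrite P2 | by rewrite e_sym P1 | by rewrite e_sym P2 ].

Lemma induced_cycle6 a b d : a \in s -> b \in s -> d \in s -> a != b -> a != d -> b != d ->
  induced_cycle a (mid a b) [:: b; mid b d; d] (mid d a).
Proof.
move=> As Bs Ds ab ad bd.
have [ba da db] : [/\ b != a, d != a & d != b] by rewrite ![_ == a]eq_sym [d == b]eq_sym.
check_edges.
Qed.

Lemma induced_cycle8 a b d f : a \in s -> b \in s -> d \in s -> f \in s ->
  uniq [:: a; b; d; f] ->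
  induced_cycle a (mid a b) [:: b; mid b d; d; mid d f; f] (mid f a).
Proof.
move=> As Bs Ds Fs /=; rewrite !inE !negb_or !andbT -!andbA.
case/and5P=> ab ad af bd /andP[bf df].
have [ba da fa] : [/\ b != a, d != a & f != a] by rewrite ![_ == a]eq_sym.
have [db fb fd] : [/\ d != b, f != b & f != d] by rewrite ![_ == b]eq_sym [f == d]eq_sym.
check_edges.
Qed.
End Homogeneous.

(** * Odd cycles *)

Section OddCycles.
Variables (q : seq V) (z0 z1 : V) (g : nat).
Notation base := [:: z1; z0].
Notation s := (q ++ base).
Hypotheses (gs : generic s)
  (hom : forall a b, a \in s -> b \in s -> a != b -> c (mid a b) = g).

Let N1 a b := @generic_nonadj s a b gs.
Let P1 a b := @mid_adjl s a b gs.
Let P2 a b := @mid_adjr s a b gs.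
Let N2 a b k := @mid_nonadj s a b k gs.

Let N3 a b a' b' : a \in s -> b \in s -> a != b -> a' \in s -> b' \in s -> a' != b' ->
  e (mid a b) (mid a' b') = false.
Proof. by move=> *; rewrite same_colour // !hom. Qed.

Let qs x : x \in q -> x \in s.
Proof. by rewrite mem_cat => ->. Qed.

Let bs x : x \in base -> x \in s.
Proof. by rewrite mem_cat orbC => ->. Qed.

Let bq x y : x \in base -> y \in q -> x != y.
Proof.
move=> xB yq; have := generic_uniq gs; rewrite cat_uniq => /and3P[_ /hasPn H _].
by apply: contraTneq (H x xB) => ->; rewrite yq.
Qed.

Ltac side := do ?[exact: qs | exact: bs | exact: bq | assumption].

Let z01 : z0 != z1.
Proof.
have := generic_uniq gs; rewrite cat_uniq => /and3P[_ _].
by rewrite /= inE andbT eq_sym.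
Qed.

Let z0B : z0 \in base. Proof. by rewrite !inE eqxx orbT. Qed.
Let z1B : z1 \in base. Proof. by rewrite !inE eqxx. Qed.

Let w := mid z0 z1.

Let w_q j : j \in q -> e w j = false.
Proof. by move=> jq; apply: N2; side. Qed.

Let w_b z : z \in base -> e z w.
Proof. by rewrite !inE => /orP[]/eqP->; [rewrite e_sym; apply: P2|apply: P1]; side. Qed.

Let w_mid a b : a \in s -> b \in s -> a != b -> e w (mid a b) = false.
Proof. by move=> *; apply: N3; side. Qed.

Let w_neq j : j \in q -> w != j.
Proof. by move=> jq; apply: contraTneq (w_b z0B) => ->; rewrite N1; side. Qed.

Let w_neq_mid a b : a \in s -> b \in q -> a != b -> w != mid a b.
Proof.
by move=> As bq' ab; apply: contraFneq (w_q bq') => ->; apply: P2; side.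
Qed.

(** Above the base, w lies in the first closure, so [y j] lies in the second and its common
    neighbours in the third; hence the three closures in [generic]. *)
Let y j := mid w j.

Let y_w j : j \in q -> e w (y j).
Proof. by move=> jq; have [] := midP (w_neq jq) (w_q jq). Qed.

Let y_j j : j \in q -> e (y j) j.
Proof. by move=> jq; rewrite e_sym; have [] := midP (w_neq jq) (w_q jq). Qed.

(* A common neighbour of z0 and z1 is not adjacent to j. *)
Let y_base j : j \in q -> e (y j) z0 = false \/ e (y j) z1 = false.
Proof.
move=> jq; case E0 : (e (y j) z0); last by left.
right; apply/negP => E1; have := y_j jq.
by rewrite (generic_common gs (bs z0B) (bs z1B) (qs jq) z01 (bq z0B jq) (bq z1B jq)) // e_sym.
Qed.

(** The argument of [generic_common] one closure higher, since w is itself a common neighbour. *)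
Let y_q j k : j \in q -> k \in q -> j != k -> e (y j) k = false.
Proof.
move=> jq kq jk; have [||z [p [zs Bp fz H]]] := @newest q base [:: j; k] gs => //.
  by move=> x; rewrite !inE => /orP[]/eqP->.
have fp := fresh_sub (@sub_closure _) fz.
have wp : w \in closure p.
  apply: (closure_common (Bp _ z0B) (Bp _ z1B) z01 _ (w_b z0B) (w_b z1B)).
  by rewrite N1; side.
move: zs; rewrite !inE => /orP[]/eqP zE; subst z.
  apply: (fresh_sep fp wp _ (w_neq kq) (w_q kq) (y_w jq) (y_j jq)).
  by apply: sub_closure; apply: H; rewrite ?inE ?eqxx ?orbT // eq_sym.
apply: (fresh_adj fp); apply: (closure_common wp _ (w_neq jq) _ (y_w jq)).
- by apply: sub_closure; apply: H; rewrite ?inE ?eqxx ?orbT.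
- by rewrite w_q.
- by rewrite e_sym y_j.
Qed.

(** If j is newest, an edge would make [y j] a common neighbour of w and [mid z k], both older than
    j. If k is newest, it would make [mid z k] a common neighbour of z and [y j]. Either way the
    newest vertex has a neighbour in a closure. *)
Let y_mid_base j k z : z \in base -> j \in q -> k \in q -> j != k -> e (y j) z = false ->
  e (y j) (mid z k) = false.
Proof.
move=> zB jq kq jk yz; have [||x [p [xs Bp fx H]]] := @newest q base [:: j; k] gs => //.
  by move=> x; rewrite !inE => /orP[]/eqP->.
have fp := fresh_sub (@sub_closure _) fx.
have wp : w \in closure p.
  apply: (closure_common (Bp _ z0B) (Bp _ z1B) z01 _ (w_b z0B) (w_b z1B)).
  by rewrite N1; side.
have zk : z != k by apply: bq.
have zy : z != y j by apply: contraTneq (y_j jq) => <-; rewrite N1; side.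
move: xs; rewrite !inE => /orP[]/eqP xE; subst x.
  apply: (fresh_sep fp wp _ (w_neq_mid (bs zB) kq zk) _ (y_w jq) (y_j jq)).
    apply: (closure_common (Bp _ zB) _ zk _ (P1 (bs zB) (qs kq) zk)).
    - by apply: H; rewrite ?inE ?eqxx ?orbT // eq_sym.
    - by rewrite (N1 (bs zB) (qs kq) zk).
    - by rewrite e_sym (P2 (bs zB) (qs kq) zk).
  by apply: w_mid; side.
rewrite e_sym; apply: (fresh_sep fx _ _ zy _ (P1 (bs zB) (qs kq) zk) (P2 (bs zB) (qs kq) zk)).
- by do 2!apply: sub_closure; apply: Bp.
- apply: (closure_common wp _ (w_neq jq) _ (y_w jq)); rewrite ?w_q // ?(e_sym j) ?y_j //.
  by apply: sub_closure; apply: H; rewrite ?inE ?eqxx ?orbT.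
- by rewrite e_sym.
Qed.

(** Otherwise w, [y j], [mid z j], z is an induced 4-cycle. *)
Let y_mid_same j z : z \in base -> j \in q -> e (y j) z = false -> e (y j) (mid z j) = false.
Proof.
move=> zB jq yz; apply/negP => E; have zj := bq zB jq.
have wz := w_b zB; have wm := w_mid (bs zB) (qs jq) zj.
have zy : z != y j by apply: contraTneq (y_j jq) => <-; rewrite N1; side.
have := no_C4 wz (y_w jq) E; rewrite (e_sym _ z) (P1 (bs zB) (qs jq) zj) (e_sym z) yz wm.
by move/(_ isT zy (w_neq_mid (bs zB) jq zj)).
Qed.

(** As for [y_mid_base], with k or l in the role of z and [y_q] giving the non-adjacency to
    [y j]. *)
Let y_mid j k l : j \in q -> k \in q -> l \in q -> j != k -> j != l -> k != l ->
  e (y j) (mid k l) = false.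
Proof.
move=> jq kq lq jk jl kl; have [||x [p [xs Bp fx H]]] := @newest q base [:: j; k; l] gs => //.
  by move=> x; rewrite !inE => /or3P[]/eqP->.
have fp := fresh_sub (@sub_closure _) fx.
have wp : w \in closure p.
  apply: (closure_common (Bp _ z0B) (Bp _ z1B) z01 _ (w_b z0B) (w_b z1B)).
  by rewrite N1; side.
have [P1kl P2kl] := (P1 (qs kq) (qs lq) kl, P2 (qs kq) (qs lq) kl).
have neq i : i \in q -> i != y j.
  by move=> iq; apply: contraTneq (y_w jq) => <-; rewrite w_q.
have yp : j \in p -> y j \in closure (closure p).
  move=> jp; apply: (closure_common wp (sub_closure jp) (w_neq jq) _ (y_w jq)).
    by rewrite w_q.
  by rewrite e_sym y_j.
move: xs; rewrite !inE => /or3P[]/eqP xE; subst x.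
- apply: (fresh_sep fp wp _ (w_neq_mid (qs kq) lq kl) _ (y_w jq) (y_j jq)).
    apply: (closure_common _ _ kl _ P1kl).
    - by apply: H; rewrite ?inE ?eqxx ?orbT // eq_sym.
    - by apply: H; rewrite ?inE ?eqxx ?orbT // eq_sym.
    - by rewrite (N1 (qs kq) (qs lq) kl).
    - by rewrite e_sym.
  by apply: w_mid; side.
- rewrite e_sym in P1kl; rewrite e_sym in P2kl.
  rewrite e_sym; apply: (fresh_sep fx _ _ (neq l lq) _ P2kl P1kl).
  + by do 2!apply: sub_closure; apply: H; rewrite ?inE ?eqxx ?orbT // eq_sym.
  + by apply: yp; apply: H; rewrite ?inE ?eqxx ?orbT.
  + by rewrite e_sym y_q.
- rewrite e_sym; apply: (fresh_sep fx _ _ (neq k kq) _ P1kl P2kl).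
  + by do 2!apply: sub_closure; apply: H; rewrite ?inE ?eqxx ?orbT.
  + by apply: yp; apply: H; rewrite ?inE ?eqxx ?orbT.
  + by rewrite e_sym y_q.
Qed.

(** Otherwise w, [y j], [mid j k], [y k] is an induced 4-cycle: [y j] and [y k] have the same
    colour. *)
Let y_mid_or j k : j \in q -> k \in q -> j != k -> c (y j) = c (y k) ->
  e (y j) (mid j k) = false \/ e (y k) (mid j k) = false.
Proof.
move=> jq kq jk cc; case E : (e (y j) (mid j k)); last by left.
right; apply/negP => E'; have wm := w_mid (qs jq) (qs kq) jk.
have yy : y j != y k by apply: contraFneq (y_q jq kq jk) => ->; apply: y_j.
have := @no_C4 w (y j) (mid j k) (y k) (y_w jq) E; rewrite (e_sym (mid j k)) => /(_ E').
rewrite (e_sym _ w) => /(_ (y_w kq) (w_neq_mid (qs jq) kq jk) yy).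
by rewrite wm (same_colour cc).
Qed.

(** Seven vertices j and six values of f: two of them agree on the colour of [y j] and on its
    adjacency to z0. If both are adjacent to z0, neither is adjacent to z1 by [y_base], so z can be
    chosen for both. *)
Lemma odd_witness : 6 < size q ->
  exists z j k l, [/\ z \in base, j \in q, k \in q & l \in q] /\
    [/\ uniq [:: j; k; l], e (y j) z = false & e (y j) (mid j k) = false].
Proof.
move=> szq; have uq : uniq q by have := generic_uniq gs; rewrite cat_uniq => /and3P[].
pose f j := (e (y j) z0, c (y j)).
have : ~~ uniq (map f q).
  apply/negP => /uniq_leq_size H; have := H [seq (a, b) | a <- [:: true; false], b <- [:: 1; 2; 3]].
  rewrite size_map size_allpairs leqNgt szq => /(_ _)/negP; apply; rewrite // => _ /mapP[j _ ->].
  by apply/allpairsP; exists (f j); rewrite c3 /f; case: (e _ z0); rewrite !inE.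
move=> /(uniqPn (f z0))[a [b [ab]]]; rewrite size_map => bq' E.
have aq' := ltn_trans ab bq'.
rewrite (nth_map z0) // (nth_map z0) // in E; case: E => E0 Ec.
set j := nth z0 q a in E0 Ec; set k := nth z0 q b in E0 Ec.
have jq : j \in q by apply: mem_nth.
have kq : k \in q by apply: mem_nth.
have jk : j != k by rewrite nth_uniq // ltn_eqF.
have [z [zB jz kz]] : exists z, [/\ z \in base, e (y j) z = false & e (y k) z = false].
  case E : (e (y j) z0); last by exists z0; rewrite -E0 E.
  exists z1; split=> //; first by case: (y_base jq) => //; rewrite E.
  by case: (y_base kq) => //; rewrite -E0 E.
have [l lq /norP[lj lk]] : exists2 l, l \in q & ~~ ((l == j) || (l == k)).
  apply/hasP; rewrite has_predC; apply/negP => /allP sub.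
  have : size q <= size [:: j; k] by apply: uniq_leq_size => // x /sub; rewrite !inE.
  by rewrite leqNgt (leq_trans _ szq).
(* The choice of z is symmetric in j and k, so they may be swapped here. *)
case: (y_mid_or jq kq jk Ec) => H.
  exists z, j, k, l; split=> //; split=> //.
  by rewrite /= !inE negb_or jk ![_ == l]eq_sym lj lk.
exists z, k, j, l; split=> //; split=> //.
  by rewrite /= !inE negb_or eq_sym jk ![_ == l]eq_sym lj lk.
by rewrite -mid_sym // N1; side.
Qed.

Section Witness.
Variables (z j k l : V).
Hypotheses (zB : z \in base) (jq : j \in q) (kq : k \in q) (lq : l \in q).
Hypotheses (jkl : uniq [:: j; k; l]) (yz : e (y j) z = false)
  (yjk : e (y j) (mid j k) = false).

Let dist : [/\ j != k, j != l & k != l] /\ [/\ k != j, l != j & l != k].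
Proof.
move: jkl; rewrite /= !inE !negb_or !andbT => /andP[/andP[jk jl] kl].
by rewrite ![_ == j]eq_sym [l == k]eq_sym.
Qed.

Ltac solve_edge :=
  first [ exact: w_b | exact: y_w | exact: y_j
        | apply: P1; side; fail | apply: P2; side; fail | rewrite e_sym; apply: P2; side; fail
        | apply/negbT; first
          [ assumption | exact: w_q | exact: y_q | apply: w_mid; side; fail
          | exact: y_mid_base | exact: y_mid_same | exact: y_mid
          | rewrite e_sym; assumption
          | apply: N1; side; fail | apply: N2; side; fail | apply: N3; side; fail
          | rewrite e_sym; apply: N2; side; fail ] ].

(** Here and below, an alternating cycle of even length gains one vertex because w reaches j only
    through [y j]. *)
Lemma induced_cycle5 : induced_cycle z w [:: y j; j] (mid z j).
Proof.
have [[jk jl kl] [kj lj lk]] := dist.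
have [zj zk zl] := And3 (bq zB jq) (bq zB kq) (bq zB lq).
have [jz kz lz] : [/\ j != z, k != z & l != z] by rewrite ![_ == z]eq_sym.
rewrite /induced_cycle /=; do ?[apply/andP; split] => //; solve_edge.
Qed.

Lemma induced_cycle7 : induced_cycle z w [:: y j; j; mid j k; k] (mid z k).
Proof.
have [[jk jl kl] [kj lj lk]] := dist.
have [zj zk zl] := And3 (bq zB jq) (bq zB kq) (bq zB lq).
have [jz kz lz] : [/\ j != z, k != z & l != z] by rewrite ![_ == z]eq_sym.
rewrite /induced_cycle /=; do ?[apply/andP; split] => //; solve_edge.
Qed.

Lemma induced_cycle9 : induced_cycle z w [:: y j; j; mid j k; k; mid k l; l] (mid z l).
Proof.
have [[jk jl kl] [kj lj lk]] := dist.
have [zj zk zl] := And3 (bq zB jq) (bq zB kq) (bq zB lq).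
have [jz kz lz] : [/\ j != z, k != z & l != z] by rewrite ![_ == z]eq_sym.
rewrite /induced_cycle /=; do ?[apply/andP; split] => //; solve_edge.
Qed.
End Witness.
End OddCycles.

Definition ramsey9 (R : nat) : Prop :=
  forall (T : eqType) (col : T -> T -> nat) (s : seq T),
    (forall a b, col a b \in [:: 1; 2; 3]) -> R <= size s ->
    exists g s', [/\ g \in [:: 1; 2; 3], subseq s' s, size s' = 9
                   & pairwise (fun a b => col a b == g) s'].

Lemma generic_cycle R s t : ramsey9 R -> generic s -> R <= size s ->
  t \in [:: 5; 6; 7; 8; 9] ->
  exists x y s' z, size s' = t - 3 /\ induced_cycle x y s' z.
Proof.
move=> HR gs szs t5.
have [g [s' [_ ss sz' pw]]] := HR V (fun a b => c (mid a b)) s (fun _ _ => c3 _) szs.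
have gs' := generic_subseq ss gs.
(* Ramsey colours pairs in list order only; [mid_sym] gives both orders. *)
have hom a b : a \in s' -> b \in s' -> a != b -> c (mid a b) = g.
  move=> As Bs ab; have ms := mid_sym ab (generic_nonadj gs' As Bs ab).
  suff : (c (mid a b) == g) || (c (mid b a) == g) by rewrite -ms orbb => /eqP.
  elim: (s') pw As Bs => //= x p IH /andP[/allP Hx /IH {}IH]; rewrite !inE.
  case/orP=> [/eqP ax|ap] /orP[/eqP bx|bp]; last exact: IH.
  - by rewrite ax bx eqxx in ab.
  - by rewrite ax Hx.
  - by rewrite bx Hx ?orbT.
have us := generic_uniq gs'.
(* Nine vertices: the two oldest, at the end, form the base, and the other seven are what
   [odd_witness] needs. *)
case: s' sz' us hom gs' {pw ss} => [|a1[|a2[|a3[|a4[|a5[|a6[|a7[|z1[|z0[|]]]]]]]]]] // _ us hom gs'.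
have us4 : uniq [:: a1; a2; a3; a4].
  by move: us; rewrite (_ : [:: a1, a2 & _] = [:: a1; a2; a3; a4] ++ [:: a5; a6; a7; z1; z0]) // cat_uniq => /and3P[].
have [A1 A2 A3 A4] : [/\ a1 \in [:: a1; a2; a3; a4; a5; a6; a7; z1; z0],
    a2 \in [:: a1; a2; a3; a4; a5; a6; a7; z1; z0],
    a3 \in [:: a1; a2; a3; a4; a5; a6; a7; z1; z0]
    & a4 \in [:: a1; a2; a3; a4; a5; a6; a7; z1; z0]] by rewrite !inE !eqxx !orbT.
pose q := [:: a1; a2; a3; a4; a5; a6; a7].
have [z [j [k [l [[zB jq kq lq] [jkl yz yjk]]]]]] := @odd_witness q z0 z1 g gs' hom isT.
move: t5; rewrite !inE => /or4P[/eqP->|/eqP->|/eqP->|/orP[]/eqP->].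
- by do 4!eexists; split; last exact: (@induced_cycle5 q z0 z1 g gs' hom z j k l).
- have [a12 a13 a23] : [/\ a1 != a2, a1 != a3 & a2 != a3].
    by move: us4; rewrite /= !inE !negb_or -!andbA => /and5P[-> -> _ -> _].
  by do 4!eexists; split; last exact: (induced_cycle6 gs' hom A1 A2 A3 a12 a13 a23).
- by do 4!eexists; split; last exact: (@induced_cycle7 q z0 z1 g gs' hom z j k l).
- by do 4!eexists; split; last exact: (induced_cycle8 gs' hom A1 A2 A3 A4 us4).
- by do 4!eexists; split; last exact: (@induced_cycle9 q z0 z1 g gs' hom z j k l).
Qed.

Definition closure_bound (k : nat) : nat := k + 2 * k ^ 2.

(** Greedy choice: when no vertex is fresh, the triple closure of the current sequence dominates. *)
Lemma generic_or_dominated R :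
  (exists2 s, generic s & size s = R) \/
  (exists2 S, size S <= iter 3 closure_bound R &
     forall v, exists2 x, x \in S & (x == v) || e x v).
Proof.
have bound_mono a b : a <= b -> closure_bound a <= closure_bound b.
  by move=> ab; rewrite leq_add // leq_mul2l leq_exp2r.
suff : forall k, k <= R -> (exists2 s, generic s & size s = k) \/
  (exists2 S, size S <= iter 3 closure_bound R &
     forall v, exists2 x, x \in S & (x == v) || e x v) by apply.
elim=> [_|k IH kR]; first by left; exists [::].
case: (IH (ltnW kR)) => [[s gs sk]|]; last by right.
have [z fz|none] := pickP (fresh (closure (closure (closure s)))).
  by left; exists (z :: s); rewrite /= ?sk ?fz.
right; exists (closure (closure (closure s))).
  have H S b : size S <= b -> size (closure S) <= closure_bound b.
    by move=> /bound_mono; apply: leq_trans (size_closure S).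
  by do 3!apply: (H); rewrite sk ltnW.
move=> v; have := none v; rewrite /fresh => /negbT /allPn[x xS].
by rewrite negb_and !negbK => H; exists x.
Qed.

End Graph.

(** * Cycles given by adjacencies as induced subgraphs *)

Lemma induced_path_nth (V : finType) (e : rel V) x0 x s i j : induced_path e x s ->
  i < j -> j <= size s -> e (nth x0 (x :: s) i) (nth x0 (x :: s) j) = (j == i.+1).
Proof.
elim: s x i j => [|y s IH] x i j /=; first by case: i j => [|i] [|j].
case/and3P=> exy /(all_nthP x0) nx ps; case: j => // j.
case: i => [_|i ij js]; last exact: (IH y).
case: j => [|j] js /=; first by rewrite exy.
exact/negbTE/nx.
Qed.

Lemma induced_cycle_nth (V : finType) (e : rel V) x0 x y s z i j :
  induced_cycle e x y s z -> i < j -> j <= (size s).+2 ->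
  let L := x :: y :: rcons s z in
  e (nth x0 L i) (nth x0 L j) = (j == i.+1) || ((i == 0) && (j == (size s).+2)).
Proof.
case/and4P=> exy /(all_nthP x0) nx exz ps ij js /=.
case: i ij => [|i] ij; last first.
  by case: j ij js => // j ij js; rewrite (induced_path_nth x0 ps) ?size_rcons ?orbF.
case: j ij js => // -[_ _|j _ js] /=; first by rewrite exy.
rewrite nth_rcons; case: ltngtP => lt_j.
- by rewrite (negbTE (nx _ lt_j)); lia.
- by lia.
- by rewrite exz; lia.
Qed.

Lemma cycle_adj_lt t (i j : 'I_t) : i < j ->
  cycle_adj i j = (j == i.+1 :> nat) || ((i == 0 :> nat) && (j.+1 == t)).
Proof.
move=> ij; have jt := ltn_ord j; rewrite /cycle_adj.
have -> : i != j by apply: contraTneq ij => ->; rewrite ltnn.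
rewrite modn_small; last exact: leq_ltn_trans jt.
case: (ltngtP j.+1 t) => jt'; first by rewrite modn_small //; lia.
- by lia.
- by rewrite jt' modnn; lia.
Qed.

(** From length 5 on, a vertex of a cycle is determined by its neighbours; in the 4-cycle opposite
    vertices share theirs. A common neighbour i + 1 forces j = i + 2, and then the other neighbour
    of i is not adjacent to j. *)
Lemma cycle_adj_inj t (i j : 'I_t) : 4 < t ->
  (forall k, cycle_adj i k = cycle_adj j k) -> i = j.
Proof.
wlog ij : i j / i <= j.
  move=> W t5 H; case: (leqP i j) => [le|/ltnW le]; first exact: W.
  by apply/esym; apply: W => // k; rewrite H.
move=> t5 H; apply/val_inj/eqP; apply: contraT => nij.
have lt_ij : i < j by rewrite ltn_neqAle nij.
have jt := ltn_ord j.
have irr : cycle_adj i j = false by rewrite H /cycle_adj eqxx.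
rewrite cycle_adj_lt // in irr.
have lt1 : i.+1 < t by lia.
have ji : j = i.+2 :> nat.
  have := H (Ordinal lt1); rewrite (@cycle_adj_lt _ i) // eqxx /=.
  by rewrite cycle_adj_sym cycle_adj_lt /=; lia.
case: (posnP i) => i0.
  have lt2 : t.-1 < t by lia.
  by have := H (Ordinal lt2); rewrite !cycle_adj_lt /=; lia.
have lt2 : i.-1 < t by lia.
have := H (Ordinal lt2).
by rewrite (cycle_adj_sym i) (cycle_adj_sym j) !cycle_adj_lt /=; lia.
Qed.

Lemma induced_cycle_in (G : sgraph) (x y z : vertex G) s t : 4 < t -> size s = t - 3 ->
  induced_cycle (@adj G) x y s z -> induced_in (Cycle t) G.
Proof.
move=> t5 sz cyc; pose f (i : 'I_t) := nth x (x :: y :: rcons s z) i.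
have f_lt (i j : 'I_t) : i < j -> adj (f i) (f j) = cycle_adj i j.
  move=> ij; have jt := ltn_ord j.
  rewrite (induced_cycle_nth x cyc) ?cycle_adj_lt // sz; last by lia.
  by congr (_ || (_ && _)); lia.
have f_adj (i j : 'I_t) : adj (f i) (f j) = cycle_adj i j.
  case: (ltngtP i j) => [/f_lt//|ji|/val_inj->]; last by rewrite adj_irr cycle_adj_irr.
  by rewrite adj_sym cycle_adj_sym f_lt.
exists f; split=> // i j E; apply: cycle_adj_inj t5 _ => k.
by rewrite -!f_adj E.
Qed.

(** * Triangle-free graphs *)

(** This is (2y - d)^2 >= 0. *)
Lemma four_mul_le d y : 4 * d * y <= 4 * y ^ 2 + d ^ 2.
Proof. by have [+ _] := nat_Cauchy (2 * y) d; rewrite -!mulnn; lia. Qed.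

(* From (b - a)(2a - b) >= 0 one gets b^2 <= 3ab - 2a^2, hence a < 2d. *)
Lemma no_large_class a d D : D + 1 <= 3 * a -> a <= D + 1 - a -> d * 6 <= D -> 0 < d ->
  4 * a * D <= 4 * (a * (d + (a - 1))) + (D + 1 - a) * D -> False.
Proof.
move=> ag half D6 d0.
pose b := D + 1 - a; have DE : D = a + b - 1 by lia.
have [ab b2a] : a <= b /\ b <= 2 * a by lia.
have a0 : 0 < a by lia.
rewrite -/b {1 2}DE => quad.
have conv : b * b + 2 * (a * a) <= 3 * (a * b) by nia.
have : b + 2 * (a * a) <= 4 * (a * d) by nia.
(* This contradicts 3a >= D + 1 > 6d. *)
nia.
Qed.

Section Moore.
Variables (V : finType) (e : rel V) (c : V -> nat).
Hypotheses (e_sym : symmetric e) (e_irr : irreflexive e).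
Hypothesis no_C4 : forall x y z t, e x y -> e y z -> e z t -> e t x ->
  x != z -> y != t -> e x z || e y t.
Hypothesis no_C3 : forall x y z, e x y -> e y z -> e x z = false.
Hypothesis diam2 : forall x y, x != y -> ~~ e x y -> exists z, e x z && e y z.
Hypothesis c3 : forall x, c x \in [:: 1; 2; 3].
Hypothesis c_proper : forall x y, e x y -> c x != c y.

Lemma common_uniq u v x y : u != v -> e u x -> e v x -> e u y -> e v y -> x = y.
Proof.
move=> uv ux vx uy vy; apply/eqP; apply: contraT => xy.
have [xv xu yu] : [/\ e x v, e x u & e y u] by rewrite e_sym vx e_sym ux e_sym.
by have := no_C4 ux xv vy yu uv xy; rewrite (no_C3 ux xv) (no_C3 xu uy).
Qed.

(** Each neighbour y of u goes to itself if adjacent to v, else to a common neighbour with v. Two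
    moved vertices with one image would be two common neighbours of u and that image; a moved and a
    fixed one would form a triangle with u. *)
Lemma degree_nonadj u v : u != v -> ~~ e u v -> #|e u| <= #|e v|.
Proof.
move=> uv euv.
pose f y := if e y v then y else mid e y v.
have fP y : e u y -> e v (f y) /\ (f y == y) || e y (f y).
  move=> uy; rewrite /f; case E : (e y v); first by rewrite e_sym E eqxx.
  have yv : y != v by apply: contraNneq euv => <-.
  by have [-> ->] := midP diam2 yv E; rewrite orbT.
have f_inj : {in e u &, injective f}.
  move=> y y' uy uy' E; have [vf fy] := fP y uy; have [_ fy'] := fP y' uy'.
  rewrite -E in fy'.
  have nuf : e u (f y) -> f y = y.
    by case/orP: fy => [/eqP//|yf]; rewrite (no_C3 uy yf).
  have uf : u != f y by apply: contraNneq euv => ->; rewrite e_sym.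
  case/orP: fy => [/eqP fyE|yf]; case/orP: fy' => [/eqP fyE'|yf'].
  - by rewrite -fyE.
  - by move: yf'; rewrite fyE e_sym (no_C3 _ uy') // e_sym.
  - by move: yf; rewrite fyE' e_sym (no_C3 _ uy) // e_sym.
  - by apply: (common_uniq uf); rewrite // e_sym.
rewrite -(card_in_imset f_inj); apply: subset_leq_card; apply/subsetP => _ /imsetP[y uy ->].
by have [] := fP y uy.
Qed.

(** A vertex x outside the closed neighbourhoods of u and v has the degree of both. *)
Lemma dominated_or_regular :
  (exists u v, forall x, ((u == x) || e u x) || ((v == x) || e v x)) \/
  (forall u v, #|e u| = #|e v|).
Proof.
have [/existsP[u /existsP[v /forallP H]]|H] :=
  boolP [exists u, exists v, forall x, ((u == x) || e u x) || ((v == x) || e v x)].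
  by left; exists u, v.
right=> u v; have [x Hx] : exists x, ~~ (((u == x) || e u x) || ((v == x) || e v x)).
  by apply/existsP; rewrite -negb_forall; move/existsPn: H => /(_ u) /existsPn /(_ v).
move: Hx; rewrite !negb_or => /andP[/andP[ux eux] /andP[vx evx]].
have E z : z != x -> ~~ e z x -> #|e z| = #|e x|.
  move=> zx ezx; apply/eqP; rewrite eqn_leq !degree_nonadj //.
    by rewrite eq_sym.
  by rewrite e_sym.
by rewrite !E.
Qed.

Section Regular.
Variable d : nat.
Hypothesis reg : forall u, #|e u| = d.

(** The entries of the squared adjacency matrix A; [codegreeE] is the Moore identity A^2 = d I + (J
    - I - A). *)
Definition codegree (u v : V) : nat := \sum_x (e x u && e x v).

Lemma sum_adj u : \sum_x (e x u : nat) = d.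
Proof.
rewrite -(reg u) -sum1_card [RHS]big_mkcond; apply: eq_bigr => x _.
by rewrite unfold_in e_sym; case: (e _ _).
Qed.

Lemma codegreeE u v : codegree u v = if u == v then d else ~~ e u v.
Proof.
rewrite /codegree; case: eqVneq => [->|uv].
  by under eq_bigr do rewrite andbb; exact: sum_adj.
case E : (e u v).
  rewrite big1 // => x _; apply/eqP; rewrite eqb0; apply/negP => /andP[xu xv].
  by have := no_C3 xu E; rewrite xv.
have [z /andP[uz vz]] := diam2 uv (negbT E).
rewrite (bigD1 z) //= ![e z _]e_sym uz vz big1 // => x xz.
apply/eqP; rewrite eqb0; apply: contra xz => /andP[xu xv].
by apply/eqP; apply: (common_uniq uv); rewrite // e_sym.
Qed.

(** Counting walks of length 2 from u in two ways gives d^2 = d + (#|V| - 1 - d). *)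
Lemma card_Moore (u : V) : #|V| = d ^ 2 + 1.
Proof.
have : \sum_v codegree u v = d * d.
  rewrite exchange_big /= -{2}(sum_adj u) big_distrr /=; apply: eq_bigr => x _.
  have [xu|nxu] := boolP (e x u); last by rewrite muln0 big1.
  under eq_bigr do rewrite e_sym; exact: etrans (sum_adj x) (esym (muln1 d)).
under eq_bigr do rewrite codegreeE.
rewrite (bigD1 u) //= eqxx => E.
have deg : \sum_(v | v != u) (e v u : nat) = d.
  by have := sum_adj u; rewrite (bigD1 u) //= e_irr.
have split v : v != u -> 1 = (if u == v then d else ~~ e u v) + (e v u : nat).
  by rewrite eq_sym e_sym => /negbTE->; case: (e _ _).
have : \sum_(v | v != u) 1 = #|V|.-1.
  by rewrite sum1dep_card -(cardC1 u); apply: eq_card => v; rewrite !inE.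
rewrite [LHS](eq_bigr _ split) big_split /= deg.
have : 0 < #|V| by apply/card_gt0P; exists u.
move: E; set S := \sum_(v | v != u) _; rewrite -mulnn => dE VE V0.
by rewrite -(prednK VE) -V0; lia.
Qed.

(** Let x v be the number of neighbours of v in a colour class I with at least a third of the
    vertices. Two distinct vertices of I have exactly one common neighbour, which fixes the sums of
    x and x^2. For d >= 6 this contradicts that (2x - d)^2 has a non-negative sum outside I. *)
Lemma degree_small : 0 < #|V| -> d < 6.
Proof.
move=> /card_gt0P[u0 _]; have nE := card_Moore u0; rewrite ltnNge; apply/negP => d6.
have [g ag] : exists g, #|V| <= 3 * #|[pred x | c x == g]|.
  have : #|V| = #|[pred x | c x == 1]| + #|[pred x | c x == 2]| + #|[pred x | c x == 3]|.
    rewrite -!sum1_card -[LHS](eq_bigr _ (fun _ _ => erefl)).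
    rewrite [X in _ = X + _ + _]big_mkcond [X in _ = _ + X + _]big_mkcond.
    rewrite [X in _ = _ + _ + X]big_mkcond -!big_split; apply: eq_bigr => x _ /=.
    by rewrite !inE; have := c3 x; rewrite !inE => /or3P[]/eqP->.
  have [le1 _|lt1] := leqP #|V| (3 * #|[pred x | c x == 1]|); first by exists 1.
  have [le2 _|lt2] := leqP #|V| (3 * #|[pred x | c x == 2]|); first by exists 2.
  by move=> E; exists 3; lia.
set I := [pred x | c x == g] in ag; set a := #|I| in ag.
pose x v := \sum_(u in I) (e v u : nat).
have S1 : \sum_v x v = a * d.
  by rewrite exchange_big /= (eq_bigr (fun=> d)) ?sum_nat_const // => u _; apply: sum_adj.
have S2 : \sum_v x v ^ 2 = a * (d + (a - 1)).
  transitivity (\sum_(u in I) \sum_(u' in I) codegree u u').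
    rewrite [RHS](eq_bigr (fun u => \sum_v \sum_(u' in I) (e v u && e v u' : nat))); last first.
      by move=> u _; rewrite exchange_big.
    rewrite [RHS]exchange_big; apply: eq_bigr => v _.
    rewrite -mulnn /x big_distrl; apply: eq_bigr => u _ /=.
    by rewrite big_distrr; apply: eq_bigr => u' _ /=; rewrite mulnb.
  rewrite {1}/a -sum_nat_const; apply: eq_bigr => u uI.
  rewrite (bigD1 u) //= codegreeE eqxx; congr (_ + _).
  rewrite (eq_bigr (fun=> 1)) => [|u' /andP[u'I nu]]; last first.
    rewrite codegreeE eq_sym (negbTE nu); apply/eqP; rewrite eqb1.
    by apply/negP => /c_proper; move: uI u'I; rewrite !inE => /eqP-> /eqP->; rewrite eqxx.
  rewrite sum1_card /a (cardD1 u I) uI addKn; apply: eq_card => v.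
  by rewrite !inE andbC.
have xI v : v \in I -> x v = 0.
  move=> vI; apply: big1 => u uI; apply/eqP; rewrite eqb0.
  by apply/negP => /c_proper; move: uI vI; rewrite !inE => /eqP-> /eqP->; rewrite eqxx.
have xd v : x v <= d.
  rewrite -(sum_adj v) [X in _ <= X](bigID (mem I)) /=.
  apply: leq_trans (leq_addr _ _); apply: leq_sum => u _.
  by rewrite e_sym.
have cI : #|[predC I]| = #|V| - a by rewrite -(cardC I) addKn.
have out F : (forall v, v \in I -> F v = 0) -> \sum_v F v = \sum_(v in [predC I]) F v.
  by move=> F0; rewrite (bigID (mem I)) /= big1.
(* The edges leaving I, with at most d at each vertex outside. *)
have half : a * d <= (#|V| - a) * d.
  by rewrite -S1 out // -cI -sum_nat_const; apply: leq_sum.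
(* The sum of (2 * x v - d)^2 over v outside I, where all of x is supported. *)
have quad : 4 * d * (a * d) <= 4 * (a * (d + (a - 1))) + (#|V| - a) * d ^ 2.
  rewrite -S1 -S2 !out => [|v /xI->//|//].
  rewrite -cI -sum_nat_const !big_distrr /= -big_split /=; apply: leq_sum => v _.
  exact: four_mul_le.
have aV : a <= #|V| by apply: max_card.
rewrite leq_pmul2r in half; last by lia.
have D6 : d * 6 <= d ^ 2 by rewrite -mulnn leq_mul2l d6 orbT.
have dD : 4 * d * (a * d) = 4 * a * d ^ 2 by rewrite -mulnn; lia.
rewrite nE in ag half quad; rewrite dD in quad.
by apply: no_large_class ag half _ _ quad => //; lia.
Qed.
End Regular.

(** In the regular case a vertex and its at most five neighbours dominate, because the diameter is
    2. *)
Lemma moore_dominated : exists2 S, size S <= 6 &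
  forall v, exists2 x, x \in S & (x == v) || e x v.
Proof.
case: dominated_or_regular => [[u [v H]]|reg].
  exists [:: u; v] => // x; case/orP: (H x) => ux; first by exists u; rewrite ?inE ?eqxx.
  by exists v; rewrite ?inE ?eqxx ?orbT.
have [u _|V0] := pickP (fun _ : V => true); last by exists [::] => // v; have := V0 v.
have dsmall := @degree_small #|e u| (fun v => reg v u) _.
exists (u :: enum (e u)); first by rewrite /= -cardE dsmall //; apply/card_gt0P; exists u.
move=> v; case: (eqVneq u v) => [<-|uv]; first by exists u; rewrite ?inE ?eqxx.
have [uv'|nuv] := boolP (e u v).
  by exists v; rewrite ?eqxx // inE mem_enum [v \in _]uv' orbT.
have [z /andP[uz vz]] := diam2 uv nuv.
by exists z; rewrite 1?e_sym ?vz ?orbT // inE mem_enum [z \in _]uz orbT.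
Qed.
End Moore.

(** * Dominating sets for the graph classes and the conclusion *)

Lemma no_induced_C4 (G : sgraph) : ~ induced_in (Cycle 4) G ->
  forall x y z t : vertex G, adj x y -> adj y z -> adj z t -> adj t x ->
  x != z -> y != t -> adj x z || adj y t.
Proof.
move=> noC4 x y z t xy yz zt tx xz yt; apply: contraT; rewrite negb_or => /andP[nxz nyt].
case: noC4; pose L := [:: x; y; z; t]; exists (fun i : 'I_4 => nth x L i).
have neq a b : adj a b -> a != b :> vertex G by apply: contraTneq => ->; rewrite adj_irr.
have uL : uniq L.
  rewrite /= !inE !negb_or xz yt !neq ?xy ?yz ?zt //.
  by rewrite adj_sym.
split=> [i j /eqP|]; first by rewrite nth_uniq // => /eqP/val_inj.
have [zx ty] : adj z x = false /\ adj t y = false by rewrite ![adj _ x]adj_sym [adj t y]adj_sym !(negbTE nxz) !(negbTE nyt).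
have [yx zy tz xt] : [/\ adj y x, adj z y, adj t z & adj x t] by split; rewrite adj_sym.
by case=> [[|[|[|[|]]]] ?] // [[|[|[|[|]]]] ?] //=;
  rewrite /cycle_adj /= ?adj_irr ?xy ?yz ?zt ?tx ?(negbTE nxz) ?(negbTE nyt) ?zx ?ty ?yx ?zy ?tz ?xt.
Qed.

Lemma no_triangle (G : sgraph) : ~ induced_in (Cycle 3) G ->
  forall x y z : vertex G, adj x y -> adj y z -> adj x z = false.
Proof.
move=> noC3 x y z xy yz; apply/negP => xz; case: noC3.
pose L := [:: x; y; z]; exists (fun i : 'I_3 => nth x L i).
have neq a b : adj a b -> a != b :> vertex G by apply: contraTneq => ->; rewrite adj_irr.
have uL : uniq L by rewrite /= !inE !negb_or !neq.
split=> [i j /eqP|]; first by rewrite nth_uniq // => /eqP/val_inj.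
have [yx zy zx] : [/\ adj y x, adj z y & adj z x] by split; rewrite adj_sym.
by case=> [[|[|[|]]] ?] // [[|[|[|]]] ?] //=; rewrite /cycle_adj /= ?adj_irr ?xy ?yz ?xz ?yx ?zy ?zx.
Qed.

Lemma diameter2_common (G : sgraph) : diameter G 2 ->
  forall u v : vertex G, u != v -> ~~ adj u v -> exists z, adj u z && adj v z.
Proof.
case=> H _ u v uv nuv; have [d [[p [pp _ lp sp]] _] d2] := H u v.
case: p sp pp lp => [|a [|b [|? ?]]] /= sp pp lp.
- by rewrite lp eqxx in uv.
- by rewrite -lp andbT in nuv pp *; rewrite pp in nuv.
- by exists a; case/and3P: pp => -> + _; rewrite lp adj_sym.
- by rewrite -sp in d2.
Qed.

(** Some two vertices are at distance exactly 2, so v is not alone; any other vertex is adjacent to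
    v or shares a neighbour with it. *)
Lemma diameter2_neighbour (G : sgraph) : diameter G 2 ->
  forall v : vertex G, exists s, adj v s.
Proof.
move=> D v; have [w vw] : exists w, v != w.
  have [_ [a [b [[p [_ up lp sp]] _]]]] := D.
  case: (eqVneq v a) => [->|va]; last by exists a.
  exists b; apply: contraTneq up => ab; rewrite ab -lp.
  by case: p sp {lp} => // x p _; rewrite /= mem_last.
have [vw'|nvw] := boolP (adj v w); first by exists w.
by have [z /andP[vz _]] := diameter2_common D vw nvw; exists z.
Qed.

Lemma dominating_set (t : nat) : t \in [:: 3; 5; 6; 7; 8; 9] -> exists M,
  forall (G : sgraph) (c : vertex G -> nat), free2 (Cycle 4) (Cycle t) G -> diameter G 2 ->
    proper3 c -> exists2 S : seq (vertex G), size S <= M &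
      forall v, exists2 x, x \in S & (x == v) || adj x v.
Proof.
rewrite inE => /orP[/eqP->|t5].
  exists 6 => G c [noC4 noC3] D [c3 cp]; apply: (@moore_dominated _ (@adj G) c) => //.
  - exact: adj_sym.
  - exact: adj_irr.
  - exact: no_induced_C4.
  - exact: no_triangle.
  - exact: diameter2_common.
  - by move=> x y /cp/eqP.
have [R HR] := ramsey3 (fun=> 9).
exists (iter 3 closure_bound R) => G c [noC4 noCt] D [c3 cp].
have C4 := no_induced_C4 noC4; have diam := diameter2_common D.
have cp' (x y : vertex G) : adj x y -> c x != c y by move=> /cp/eqP.
case: (@generic_or_dominated _ (@adj G) c (@adj_sym G) C4 c3 cp' R) => [[s gs sR]|//].
have [|x [y [s' [z [sz cyc]]]]] := @generic_cycle _ _ c (@adj_sym G) C4 diam c3 cp' R s t HR gs _ t5.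
  by rewrite sR.
case: noCt; apply: induced_cycle_in sz cyc.
by move: t5; rewrite !inE; lia.
Qed.

Theorem theorem2 (t : nat) (ht : t \in [:: 3; 5; 6; 7; 8; 9]) :
  list_3_colouring_poly_time_on
    (fun G : sgraph => free2 (Cycle 4) (Cycle t) G /\ diameter G 2).
Proof.
have [M HM] := dominating_set ht.
(* Adding a neighbour of each vertex of S makes the domination total, at the cost of doubling the
   bound. *)
apply: (@poly_time_of_domination _ (M + M)) => G c [fr D] pc.
have [S SM dom] := HM G c fr D pc.
have [nb nbP] : exists nb : vertex G -> vertex G, forall v, adj v (nb v).
  exists (fun v => odflt v [pick s | adj v s]) => v; case: pickP => // none.
  by have [s] := diameter2_neighbour D v; rewrite none.
have [_ [v0 _]] := D.
(* Copies of an arbitrary vertex pad the list to exactly M + M entries. *)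
exists (S ++ map nb S ++ nseq (M + M - (size S + size S)) v0).
  by rewrite !size_cat size_map size_nseq; lia.
move=> v; have [x xS /orP[/eqP<-|xv]] := dom v.
  by exists (nb x); rewrite // !mem_cat map_f ?orbT.
by exists x; rewrite ?mem_cat ?xS // adj_sym.
Qed.
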